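(* Let $n\ge 1$ and let $\mathcal{C}_{2n}$ be the Clifford algebra with Hermitian generators $\hat c_1,\dots,\hat c_{2n}$. Let $\hat\Lambda=\sum_{a=1}^{2n}\hat c_a\otimes\hat c_a\in\mathcal{C}_{2n}\otimes\mathcal{C}_{2n}$. (1) An operator $X\in\mathcal{C}_{2n}$ is Gaussian if and only if $X$ is even and satisfies $[\hat\Lambda,X\otimes X]=0$. (2) Any Gaussian operator $X\in\mathcal{C}_{2n}$ has a Grassmann representation of the form $$X(\theta)=C\left(\prod_{a=1}^{2k}\mu_a\right)\exp\left(\frac{i}{2}\sum_{a,b=2k+1}^{2n}M_{ab}\,\mu_a\mu_b\right),\qquad \mu_a=\sum_{b=1}^{2n}T_{ab}\theta_b,$$ for some integer $0\le k\le n$, some complex number $C$, some complex antisymmetric matrix $(M_{ab})_{2k+1\le a,b\le 2n}$ and some invertible complex $2n\times 2n$ matrix $T$.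
   Context: $\mathcal{C}_{2n}$ is the complex unital algebra generated by Hermitian $\hat c_1,\dots,\hat c_{2n}$ with $\hat c_a\hat c_b+\hat c_b\hat c_a=2\delta_{ab}\hat I$; it is identified with the algebra of all linear operators on the $2^n$-dimensional Fock space of $n$ fermionic modes, with its usual trace (so $\mathrm{Tr}(\hat I)=2^n$ and every non-trivial ordered monomial in the $\hat c$'s is traceless). The ordered monomials $\hat c_{a_1}\cdots\hat c_{a_p}$, $a_1<\dots<a_p$, form a linear basis. An operator is even (odd) if it is a linear combination of monomials of even (odd) degree. $\mathcal{C}_{2n}\otimes\mathcal{C}_{2n}$ is the ordinary (ungraded) tensor product of algebras, $(A\otimes B)(A'\otimes B')=AA'\otimes BB'$, and $[\cdot,\cdot]$ is the commutator. $\mathcal{G}_{2n}$ is the complex Grassmann (exterior) algebra with generators $\theta_1,\dots,\theta_{2n}$, $\theta_a\theta_b=-\theta_b\theta_a$, $\theta_a^2=0$. The Grassmann representation $X(\theta)\in\mathcal{G}_{2n}$ of $X\in\mathcal{C}_{2n}$ is the image of $X$ under the linear isomorphism sending $\hat I\mapsto 1$ and $\hat c_{a_1}\cdots\hat c_{a_p}\mapsto\theta_{a_1}\cdots\theta_{a_p}$ for $a_1<\dots<a_p$. Exponentials are defined by their (finite) Taylor series, and $\theta^TM\theta=\sum_{a,b}M_{ab}\theta_a\theta_b$. Gaussian operator: (a) an operator $X\in\mathcal{C}_{2n}$ with $\mathrm{Tr}(X)\neq 0$ is Gaussian iff $X(\theta)=C\exp\left(\frac{i}{2}\theta^TM\theta\right)$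 for some $C\in\mathbb{C}$ and some complex antisymmetric $2n\times2n$ matrix $M$; (b) an operator $X$ with $\mathrm{Tr}(X)=0$ is Gaussian iff $X=\lim_{m\to\infty}X_m$ for some convergent sequence of Gaussian operators $X_m\in\mathcal{C}_{2n}$ with $\mathrm{Tr}(X_m)\ne0$. *)

(* Defs.v *)
From HB Require Import structures.
From mathcomp Require Import classical_sets reals topology normedtype sequences.
From mathcomp Require Import all_boot all_order all_algebra.
From mathcomp Require Import complex mxtens.

Set Implicit Arguments.
Unset Strict Implicit.
Unset Printing Implicit Defensive.
Import Order.TTheory GRing.Theory Num.Theory numFieldNormedType.Exports.
Local Open Scope ring_scope.

(* An element of the exterior algebra on m generators is the family of its
   coefficients on the ordered monomials theta_A, A a subset of 'I_m. *)
Definition grassmann (K : comNzRingType) (m : nat) := {ffun {set 'I_m} -> K}.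

HB.instance Definition _ (K : comNzRingType) (m : nat) :=
  GRing.Lmodule.copy (grassmann K m) {ffun {set 'I_m} -> K^o}.

Section GrassmannRing.
Variables (K : comNzRingType) (m : nat).
Local Notation G := (grassmann K m).
Implicit Types (A B D S : {set 'I_m}) (x y z : G).

Definition inversions A B : nat := \sum_(a in A) \sum_(b in B) (b < a)%N.

(* theta_A * theta_B = (-1) ^ (inversions A B) theta_(A :|: B) if A and B are
   disjoint, and 0 otherwise. *)
Definition gmul x y : G :=
  [ffun S : {set 'I_m} => \sum_(A : {set 'I_m} | A \subset S)
               (-1) ^+ inversions A (S :\: A) * x A * y (S :\: A)].

Definition gone : G := [ffun S : {set 'I_m} => (S == set0)%:R].

Lemma inversionsDl A B S : A \subset B ->
  inversions B S = (inversions A S + inversions (B :\: A) S)%N.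
Proof.
move=> AB; rewrite /inversions (big_setID A) /=.
by rewrite (setIidPr AB).
Qed.

Lemma inversionsDr A B S : A \subset B ->
  inversions S B = (inversions S A + inversions S (B :\: A))%N.
Proof.
move=> AB; rewrite /inversions -big_split; apply: eq_bigr => a _ /=.
by rewrite (big_setID A) /= (setIidPr AB).
Qed.

Lemma inversions0l B : inversions set0 B = 0%N.
Proof. by rewrite /inversions big_set0. Qed.

Lemma inversions0r A : inversions A set0 = 0%N.
Proof. by rewrite /inversions big1 // => a _; rewrite big_set0. Qed.

Lemma gmulA : associative gmul.
Proof.
move=> x y z; apply/ffunP => S; rewrite !ffunE.
transitivity (\sum_(A : {set 'I_m} | A \subset S)
   \sum_(B : {set 'I_m} | (B \subset S) && (A \subset B))
   (-1) ^+ (inversions A (S :\: A) + inversions (B :\: A) (S :\: B))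
    * x A * y (B :\: A) * z (S :\: B)).
  apply: eq_bigr => A AS; rewrite ffunE big_distrr /=.
  rewrite (reindex_onto (fun B => B :\: A) (fun D => A :|: D)) /=; last first.
    move=> D; rewrite subsetD => /andP[_ dDA].
    by rewrite setDUl setDv set0U; apply/setDidPl.
  apply: eq_big => [B|B /andP[h1 /eqP h2]].
    have -> : (A :|: B :\: A == B) = (A \subset B).
      apply/eqP/idP => [<-|]; first by rewrite subsetUl.
      by move/setIidPr => AB; rewrite -{1}AB setID.
    apply/andP/andP => -[h1 h2]; split => //.
      apply/subsetP => i iB; have [/(subsetP AS)//|iA] := boolP (i \in A).
      have : i \in B :\: A by rewrite !inE iA iB.
      by move/(subsetP h1); rewrite inE => /andP[].
    by apply: setSD.
  have e : S :\: A :\: (B :\: A) = S :\: B.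
    have AB : A \subset B by rewrite -h2 subsetUl.
    by rewrite setDDl h2.
  by rewrite e exprD -!mulrA; congr (_ * _); rewrite mulrCA.
rewrite (exchange_big_dep (fun B : {set 'I_m} => B \subset S)) /=; last first.
  by move=> A B _ /andP[].
apply: eq_bigr => B BS; rewrite ffunE big_distrr /= big_distrl /=.
apply: eq_big => [A|A /andP[AS /andP[_ AB]]].
  rewrite BS /=; apply: andb_idl => AB; exact: subset_trans AB BS.
have eB : B :\: A \subset S :\: A by apply: setSD.
have e : S :\: A :\: (B :\: A) = S :\: B.
  by rewrite setDDl -{1}(setIidPr AB) setID.
rewrite (inversionsDr _ eB) e (inversionsDl _ AB) !mulrA -!exprD.
by rewrite -addnA [in LHS]addnC.
Qed.

Lemma gmul1l : left_id gone gmul.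
Proof.
move=> x; apply/ffunP => S; rewrite ffunE (bigD1 set0) ?sub0set //=.
rewrite big1 => [|A /andP[_ A0]]; last by rewrite ffunE (negPf A0) mulr0 mul0r.
by rewrite ffunE eqxx setD0 inversions0l expr0 !mul1r addr0.
Qed.

Lemma gmul1r : right_id gone gmul.
Proof.
move=> x; apply/ffunP => S; rewrite ffunE (bigD1 S) //=.
rewrite big1 => [|A /andP[AS AnS]]; last first.
  rewrite ffunE setD_eq0; have [SA|_] := boolP (S \subset A); last by rewrite mulr0.
  by case/negP: AnS; rewrite eqEsubset AS SA.
by rewrite ffunE setDv eqxx inversions0r expr0 mul1r mulr1 addr0.
Qed.

Lemma gmulDl : left_distributive gmul +%R.
Proof.
move=> x y z; apply/ffunP => S; rewrite !ffunE -big_split.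
by apply: eq_bigr => A _; rewrite ffunE mulrDr mulrDl.
Qed.

Lemma gmulDr : right_distributive gmul +%R.
Proof.
move=> x y z; apply/ffunP => S; rewrite !ffunE -big_split.
by apply: eq_bigr => A _; rewrite ffunE mulrDr.
Qed.

Lemma gone_neq0 : gone != 0.
Proof.
by apply/eqP => /ffunP/(_ set0); rewrite !ffunE eqxx => /eqP; rewrite oner_eq0.
Qed.

HB.instance Definition _ :=
  GRing.Zmodule_isNzRing.Build G gmulA gmul1l gmul1r gmulDl gmulDr gone_neq0.

Lemma gscaleE (a : K) x S : (a *: x) S = a * x S.
Proof. by rewrite ffunE. Qed.

Lemma gscaleAl (a : K) x y : a *: (x * y) = a *: x * y.
Proof.
apply/ffunP => S; rewrite gscaleE !ffunE big_distrr /=.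
by apply: eq_bigr => A _; rewrite gscaleE !mulrA; congr (_ * _ * _); rewrite mulrC.
Qed.

HB.instance Definition _ := GRing.Lmodule_isLalgebra.Build K G gscaleAl.

Lemma gscaleAr (a : K) x y : a *: (x * y) = x * (a *: y).
Proof.
apply/ffunP => S; rewrite gscaleE !ffunE big_distrr /=.
by apply: eq_bigr => A _; rewrite gscaleE mulrCA.
Qed.

HB.instance Definition _ := GRing.Lalgebra_isAlgebra.Build K G gscaleAr.

Definition gmonomial A : G := [ffun S : {set 'I_m} => (S == A)%:R].

Definition theta (a : 'I_m) : G := gmonomial [set a].

Lemma gmonomialM A B :
  gmonomial A * gmonomial B =
  if [disjoint A & B] then (-1) ^+ inversions A B *: gmonomial (A :|: B) else 0.
Proof.
have -> : gmonomial A * gmonomial B = [ffun S : {set 'I_m} =>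
    ((A \subset S) && (S :\: A == B))%:R * (-1) ^+ inversions A B].
  apply/ffunP => S; rewrite !ffunE.
  have [AS|nAS] := boolP (A \subset S); last first.
    rewrite mul0r big1 // => D DS; rewrite ffunE; case: eqP => [eD|]; last first.
      by rewrite mulr0 mul0r.
    by rewrite -eD DS in nAS.
  rewrite (bigD1 A) //= big1 ?addr0 => [|D /andP[_ /negPf nDA]]; last first.
    by rewrite ffunE nDA mulr0 mul0r.
  rewrite !ffunE eqxx mulr1 mulrC.
  by case: eqP => [->|]; rewrite ?mul0r.
have e S : (A \subset S) && (S :\: A == B) = [disjoint A & B] && (S == A :|: B).
  apply/andP/andP => [[AS /eqP <-]|[dAB /eqP ->]]; split.
  - by rewrite disjoints_subset setCD subsetUr.
  - by rewrite -{1}(setIidPr AS) setID.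
  - exact: subsetUl.
  - by rewrite setDUl setDv set0U; apply/eqP/setDidPl; rewrite disjoint_sym.
apply/ffunP => S; rewrite ffunE e; case: ifP => _ /=; last by rewrite mul0r ffunE.
by rewrite gscaleE ffunE mulrC.
Qed.

Lemma theta_sqr a : theta a * theta a = 0.
Proof.
by rewrite gmonomialM -setI_eq0 setIid -cards_eq0 cards1.
Qed.

Lemma theta_anticomm a b : theta a * theta b = - (theta b * theta a).
Proof.
have [->|ab] := eqVneq a b; first by rewrite theta_sqr oppr0.
rewrite !gmonomialM !disjoints1 !inE [b == a]eq_sym ab setUC /inversions !big_set1.
rewrite -scaleNr; congr (_ *: _); case: (ltngtP a b) ab => [||/val_inj ->].
- by rewrite expr0 expr1 opprK.
- by rewrite expr0 expr1.
- by rewrite eqxx.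
Qed.

Lemma gmonomial_prod A : \prod_(a in A) theta a = gmonomial A.
Proof.
rewrite -big_filter; set s := filter _ _.
have sA : A = [set a in s] by apply/setP => a; rewrite inE mem_filter mem_index_enum andbT.
have : sorted (fun a b : 'I_m => (a < b)%N) s.
  apply: sorted_filter => [? ? ?|]; first exact: ltn_trans.
  rewrite /index_enum; case: index_enum_key => /=.
  by have := iota_ltn_sorted 0 m; rewrite -val_enum_ord sorted_map -enumT.
rewrite {}sA; elim: s => [_|a s IHs /= pas].
  have -> : [set b in [::]] = set0 :> {set 'I_m} by apply/setP => b; rewrite !inE.
  by rewrite big_nil.
rewrite big_cons IHs; last exact: path_sorted pas.
have lt b : b \in s -> (a < b)%N.
  by move: pas; rewrite path_sortedE => [/andP[/allP h _] /h|? ? ?]; last exact: ltn_trans.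
rewrite gmonomialM disjoints1 inE; case: ifPn => [_|/negPn/lt]; last by rewrite ltnn.
rewrite /inversions big_set1 big1 => [|b]; last first.
  by rewrite inE => /lt ab; rewrite ltnNge ltnW.
by rewrite expr0 scale1r; congr gmonomial; apply/setP => b; rewrite !inE.
Qed.

End GrassmannRing.

(* The Taylor series of the exponential, cut after its term of degree m: for x
   without component on the unit, x ^+ k = 0 as soon as k > m. *)
Definition gexp (C : numFieldType) (m : nat) (x : grassmann C m) :
    grassmann C m :=
  \sum_(k < m.+1) (k`!%:R)^-1 *: x ^+ k.

Section Clifford.
Variable C : numClosedFieldType.

(* Hermitian generators of a Clifford algebra, as operators on C^d.  For m = 2n
   and d = 2^n they generate the algebra of all operators on the Fock space of n
   fermionic modes, and \tr is the usual trace. *)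
Definition clifford_generators (m d : nat) (c : 'I_m -> 'M[C]_d) : Prop :=
  (forall a, c a \is hermsymmx) /\
  (forall a b, c a *m c b + c b *m c a = (2 * (a == b)%:R)%:M).

(* By the Jordan-Wigner construction. *)
Lemma clifford_generators_exist (n : nat) :
  exists c : 'I_n.*2 -> 'M[C]_(2 ^ n), clifford_generators c.
Proof.
suff [d [c [<- hc]]] : exists (d : nat) (c : 'I_n.*2 -> 'M[C]_d),
  d = (2 ^ n)%N /\ clifford_generators c by exists c.
elim: n => [|n [d [c [dn [ch cc]]]]].
  by exists 1%N, (fun=> 0); split=> //; split=> -[].
pose X : 'M[C]_2 := \matrix_(i, j) (i != j)%:R.
pose Z : 'M[C]_2 := \matrix_(i, j) ((-1) ^+ i *+ (i == j)).
pose Y : 'M[C]_2 := \matrix_(i, j) ('i * (-1) ^+ j *+ (i != j)).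
pose c' (a : 'I_(2 + n.*2)) : 'M[C]_(2 * d) := match fintype.split a with
  | inl a0 => (if a0 == 0 then X else Y) *t 1%:M
  | inr a1 => Z *t c a1 end.
have t11 k l : (1%:M : 'M[C]_k) *t (1%:M : 'M[C]_l) = 1%:M.
  apply/matrixP => i j; case: (mxtens_indexP i) => i0 i1; case: (mxtens_indexP j) => j0 j1.
  rewrite tensmxE !mxE -natrM mulnb (can_eq (@mxtens_indexK _ _)) xpair_eqE.
  by [].
have th k l (A : 'M[C]_k) (B : 'M[C]_l) : A \is hermsymmx -> B \is hermsymmx ->
    A *t B \is hermsymmx.
  move=> /is_hermitianmxP hA /is_hermitianmxP hB; apply/is_hermitianmxP.
  by move: hA hB; rewrite expr0 !scale1r => hA hB; rewrite trmx_tens map_mxT -hA -hB.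
have D k l (A A' : 'M[C]_k) (B : 'M[C]_l) : A *t B + A' *t B = (A + A') *t B.
  by apply/matrixP => i j; rewrite !mxE mulrDl.
have D' k l (A : 'M[C]_k) (B B' : 'M[C]_l) : A *t B + A *t B' = A *t (B + B').
  by apply/matrixP => i j; rewrite !mxE mulrDr.
have S k l (z : C) : (z%:M : 'M[C]_k) *t (1%:M : 'M[C]_l) = z%:M.
  by rewrite -[z%:M]scalemx1 -[X in _ = X]scalemx1 -(t11 k l); apply/matrixP => i j; rewrite !mxE mulrA.
have S' k l (z : C) : (1%:M : 'M[C]_k) *t (z%:M : 'M[C]_l) = z%:M.
  by rewrite -[z%:M in LHS]scalemx1 -[X in _ = X]scalemx1 -(t11 k l); apply/matrixP => i j; rewrite !mxE mulrCA.
have pauli : [/\ X *m X = 1%:M, Y *m Y = 1%:M, Z *m Z = 1%:M,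
   X *m Y + Y *m X = 0 & (X *m Z + Z *m X = 0) /\ (Y *m Z + Z *m Y = 0)].
  have ii : ('i : C) * 'i = -1 by rewrite -expr2 sqrCi.
  split; last split; apply/matrixP => -[[|[|//]] hi] [[|[|//]] hj];
  rewrite !mxE !big_ord_recr !big_ord0 /= ?mxE /= ?expr0 ?expr1
    ?mulr0n ?mulr1n ?mulr0 ?mul0r ?mulr1 ?mul1r ?mulrN1 ?mulN1r ?mulrN ?mulNr ?ii ?opprK ?add0r ?addr0 ?subrr ?addNr //.
have [XX YY ZZ XY [XZ YZ]] := pauli.
exists (2 * d)%N, c'; split; first by rewrite dn expnS.
have h1 k : (1%:M : 'M[C]_k) \is hermsymmx by exact: hermitian1mx_subproof.
have hX : X \is hermsymmx.
  apply/is_hermitianmxP; rewrite expr0 scale1r; apply/matrixP => i j.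
  by rewrite !mxE eq_sym rmorph_nat.
have hZ' : Z \is hermsymmx.
  apply/is_hermitianmxP; rewrite expr0 scale1r; apply/matrixP => i j.
  by rewrite !mxE rmorphMn rmorphXn rmorphN1 eq_sym; case: eqP => [->|].
have hY : Y \is hermsymmx.
  apply/is_hermitianmxP; rewrite expr0 scale1r; apply/matrixP.
  move=> -[[|[|//]] hi] [[|[|//]] hj];
  by rewrite !mxE /= ?mulr0n ?rmorph0 // ?mulr1n ?expr0 ?expr1 ?mulr1 ?mulrN1 ?rmorphN /= ?conjCi ?opprK.
have anti (A B : 'M[C]_2) (E F : 'M[C]_d) : E *m F = F *m E -> A *m B + B *m A = 0 ->
   (A *t E) *m (B *t F) + (B *t F) *m (A *t E) = 0.
  by move=> EF AB; rewrite !tensmx_mul EF D AB tens0mx.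
split=> [a|a b].
  rewrite /c'; case: split => a'; apply: th => //; by case: ifP.
have eqs : (a == b) = (split (a : 'I_(2 + n.*2)) == split (b : 'I_(2 + n.*2))).
  by rewrite (can_eq (@splitK 2 n.*2)).
rewrite eqs; rewrite {eqs}/c'.
have e2 k : (1%:M + 1%:M : 'M[C]_k) = (2 * true%:R)%:M.
  by rewrite mulr1 -[2]/(1 + 1) raddfD.
have e0 k : 0 = (2 * false%:R)%:M :> 'M[C]_k by rewrite mulr0 raddf0.
case: (@split 2 n.*2 a) => a'; case: (@split 2 n.*2 b) => b'.
- have -> : (inl a' == inl b' :> 'I_2 + 'I_n.*2) = (a' == b') by [].
  have [<-|nab] := eqVneq a' b'.
    rewrite !tensmx_mul mulmx1 D.
    have -> : (if a' == 0 then X else Y) *m (if a' == 0 then X else Y) = 1%:M.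
      by case: ifP.
    by rewrite e2 S.
  rewrite -e0; apply: anti => //.
  case: a' b' nab => [[|[|//]] ha] [[|[|//]] hb] //= _.
  by rewrite addrC.
- rewrite -[inl _ == _]/false -e0; by apply: anti; [rewrite mulmx1 mul1mx | case: ifP].
- rewrite -[inr _ == _]/false -e0 addrC; by apply: anti; [rewrite mulmx1 mul1mx | case: ifP].
- have -> : (inr a' == inr b' :> 'I_2 + 'I_n.*2) = (a' == b') by [].
  by rewrite !tensmx_mul ZZ D' cc S'.
Qed.

Section Operators.
Variables (m d : nat) (c : 'I_m -> 'M[C]_d).

Definition cmonomial (A : {set 'I_m}) : 'M[C]_d := \prod_(a in A) c a.

Definition even_op (X : 'M[C]_d) : Prop :=
  exists f : {set 'I_m} -> C,
    X = \sum_(A : {set 'I_m} | ~~ odd #|A|) f A *: cmonomial A.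

Definition cmonomials : #|{set 'I_m}|.-tuple 'M[C]_d :=
  [tuple cmonomial (enum_val i) | i < #|{set 'I_m}|].

(* The linear isomorphism sending cmonomial A to \prod_(a in A) theta C a, read
   off the coordinates in the monomials; these are a basis of 'M[C]_d when c are
   Clifford generators with m = 2n and d = 2^n. *)
Definition grassmann_rep (X : 'M[C]_d) : grassmann C m :=
  \sum_(i < #|{set 'I_m}|)
    coord cmonomials i X *: \prod_(a in enum_val i) theta C a.

Definition exp_form (X : 'M[C]_d) : Prop :=
  exists (z : C) (M : 'M[C]_m), M^T = - M /\
    grassmann_rep X =
      z *: gexp (('i / 2) *: \sum_a \sum_b M a b *: (theta C a * theta C b)).

Definition gaussian (X : 'M[C]_d) : Prop :=
  (\tr X != 0 /\ exp_form X) \/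
  (\tr X = 0 /\ exists Y : nat -> 'M[C]_d,
     (forall j, \tr (Y j) != 0 /\ exp_form (Y j)) /\
     (Y @ \oo --> X)%classic).

(* The tensor square of 'M[C]_d is 'M[C]_(d * d), through the (ungraded)
   Kronecker product. *)
Definition Lambda : 'M[C]_(d * d) := \sum_a c a *t c a.

End Operators.

Definition commutator (d : nat) (A B : 'M[C]_d) : 'M[C]_d :=
  A *m B - B *m A.

End Clifford.

(* Main.v *)
(** In coordinates x_S on ordered monomials, and for even X, the equation
    [Lambda, X (x) X] = 0 becomes the quadratic (Pluecker) system
      sum_a (theta_a x)_S (d_a x)_T + (d_a x)_S (theta_a x)_T = 0  for all S, T,
    because left and right multiplication by c_a act as theta_a + d_a and
    theta_a - d_a.  Gaussian exponentials solve it since d_a exp(q) is a linear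
    form with antisymmetric coefficients times exp(q).  Conversely, taking
    S = A \ {a} and T = {a} expresses x_0 x_A through coordinates of smaller
    sets, so a solution with x_0 <> 0 is determined by its coordinates of degree
    at most 2, hence is an exponential.

    If x_0 = 0, choose B of minimal size with x_B <> 0.  Multiplying X by the
    rotations 1 + t c_b c_b' along a pairing of B gives solutions that converge
    to X as t -> 0 and, by minimality of B, have nonzero trace for t <> 0.  The
    relations with S = B \ {b} say that the linear forms
    nu_b = sum_a (d_a x)_(B \ b) theta_a (b in B) annihilate x.  An element
    annihilated by all nu_b is determined by its coordinates on the sets
    containing B, which identifies x with a multiple of (prod_b nu_b) y, where y
    is the part of the exponential representing c_B X that avoids B. *)
From HB Require Import structures.
Require Import Defs.
From mathcomp Require Import classical_sets reals topology normedtype sequences.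
From mathcomp Require Import all_boot all_order all_algebra perm ring.
From mathcomp Require Import complex mxtens.

Set Implicit Arguments.
Unset Strict Implicit.
Unset Printing Implicit Defensive.
Import Order.TTheory GRing.Theory Num.Theory numFieldNormedType.Exports.
Local Open Scope ring_scope.

(** * Symmetric difference with a singleton *)

Section Toggle.
Variable m : nat.
Implicit Types (a b : 'I_m) (S : {set 'I_m}).

(** Multiplication by [c a], multiplication by [theta a] and the derivative along [theta a] all move
    coordinates along this one involution. *)
Definition toggle a S := if a \in S then S :\ a else a |: S.

Lemma in_toggle a S b : (b \in toggle a S) = (b \in S) (+) (b == a).
Proof.
rewrite /toggle; case: ifP => aS; rewrite !inE; case: eqP => [->|];
  by rewrite ?aS ?addbF ?addbT.
Qed.

Lemma toggleK a : involutive (toggle a).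
Proof. by move=> S; apply/setP => b; rewrite !in_toggle -addbA addbb addbF. Qed.

Lemma toggleC a b S : toggle a (toggle b S) = toggle b (toggle a S).
Proof. by apply/setP => i; rewrite !in_toggle addbAC. Qed.

Lemma toggle_in a S : a \in S -> toggle a S = S :\ a.
Proof. by rewrite /toggle => ->. Qed.

Lemma toggle_notin a S : a \notin S -> toggle a S = a |: S.
Proof. by rewrite /toggle => /negPf ->. Qed.

Lemma odd_toggle a S : odd #|toggle a S| = ~~ odd #|S|.
Proof.
rewrite /toggle; case: ifPn => aS; last by rewrite cardsU1 aS.
by rewrite [in RHS](cardsD1 a) aS /= negbK.
Qed.

Lemma card_toggle_le a S : (#|toggle a S| <= #|S|.+1)%N.
Proof.
rewrite /toggle; case: ifPn => aS; last by rewrite cardsU1 aS.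
by apply: leq_trans (subset_leq_card (subsetDl _ _)) _.
Qed.

(** Inserting a least element matches ordered monomials: [cmonomial c (a |: S)] is then [c a] times
    [cmonomial c S], with no sign. *)
Lemma ord_set_ind (P : {set 'I_m} -> Prop) : P set0 ->
  (forall a S, (forall b, b \in S -> (a < b)%N) -> P S -> P (a |: S)) ->
  forall S, P S.
Proof.
move=> P0 PU S; have [k] := ubnP #|S|; elim: k S => // k IH S.
have [->//|[a0 a0S] leSk] := set_0Vmem S.
have [a aS' min_a] := arg_minnP val a0S; have aS : a \in S by [].
rewrite -(setD1K aS); apply: PU => [b|].
  rewrite !inE => /andP[ba bS]; rewrite ltn_neqAle min_a // andbT.
  by rewrite eq_sym.
by apply: IH; move: leSk; rewrite [#|S|](cardsD1 a) aS.
Qed.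

End Toggle.

(** The sign of moving generator [a] past the elements of [S] below it; whether [a] itself lies in
    [S] does not affect it. *)
Definition gsign (K : comNzRingType) (m : nat) (a : 'I_m) (S : {set 'I_m}) : K :=
  (-1) ^+ inversions [set a] S.

Section Sign.
Variables (K : comNzRingType) (m : nat).
Implicit Types (a b : 'I_m) (S : {set 'I_m}).

Lemma gsign_set0 a : gsign K a set0 = 1.
Proof. by rewrite /gsign inversions0r. Qed.

Lemma gsign_sqr a S : gsign K a S * gsign K a S = 1.
Proof. by rewrite /gsign -expr2 sqrr_sign. Qed.

Lemma gsign_toggle a b S : gsign K a (toggle b S) = (-1) ^+ (b < a)%N * gsign K a S.
Proof.
rewrite /gsign /inversions !big_set1 /toggle; case: ifPn => bS; last first.
  by rewrite big_setU1 //= exprD.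
by rewrite [in RHS](big_setD1 b) //= exprD mulrA -signr_addb addbb mul1r.
Qed.

Lemma gsign_toggle_id a S : gsign K a (toggle a S) = gsign K a S.
Proof. by rewrite gsign_toggle ltnn mul1r. Qed.

(** Exactly one of [a < b] and [b < a] holds, so exactly one of the two toggles flips a sign. *)
Lemma gsign_anticomm a b S : a != b ->
  gsign K a S * gsign K b (toggle a S) = - (gsign K b S * gsign K a (toggle b S)).
Proof.
move=> ab; rewrite !gsign_toggle.
by case: ltngtP ab => [||/val_inj->] /=; rewrite ?eqxx // => *; ring.
Qed.

End Sign.

(** * Left derivatives in the Grassmann algebra *)

Section GrassmannCalculus.
Variables (K : comNzRingType) (m : nat).
Implicit Types (a b : 'I_m) (S T : {set 'I_m}) (x y z : grassmann K m).
Local Notation theta := (theta K).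

Lemma gP x y : (forall S, x S = y S) -> x = y.
Proof. by move=> xy; apply/ffunP. Qed.

Lemma gmulE x y S : (x * y) S =
  \sum_(A : {set 'I_m} | A \subset S)
     (-1) ^+ inversions A (S :\: A) * x A * y (S :\: A).
Proof. by rewrite ffunE. Qed.

Lemma gE0 S : (0 : grassmann K m) S = 0.
Proof. by rewrite ffunE. Qed.
Lemma gED x y S : (x + y) S = x S + y S.
Proof. by rewrite ffunE. Qed.
Lemma gEN x S : (- x) S = - x S.
Proof. by rewrite ffunE. Qed.
Lemma gE1 S : (1 : grassmann K m) S = (S == set0)%:R.
Proof. by rewrite ffunE. Qed.
Lemma gE_sum I (r : seq I) (P : pred I) (F : I -> grassmann K m) S :
  (\sum_(i <- r | P i) F i) S = \sum_(i <- r | P i) F i S.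
Proof. exact: (big_morph (fun x : grassmann K m => x S) (fun x y =>
  gED x y S) (gE0 S)). Qed.

Definition gE := (gscaleE, gE0, gED, gEN, gE1).

Lemma theta_mulE a x S :
  (theta a * x) S = if a \in S then gsign K a S * x (toggle a S) else 0.
Proof.
rewrite gmulE; case: ifPn => aS; last first.
  rewrite big1 // => A AS; rewrite ffunE; case: eqP => [eA|]; last by rewrite mulr0 mul0r.
  by rewrite eA sub1set (negPf aS) in AS.
rewrite (bigD1 [set a]) ?sub1set //= big1 ?addr0 => [|A /andP[_ /negPf nA]]; last first.
  by rewrite ffunE nA mulr0 mul0r.
by rewrite ffunE eqxx mulr1 -toggle_in // -(gsign_toggle_id K a S).
Qed.

(** The left derivative with respect to [theta a], written on coordinates. *)
Definition dtheta a x : grassmann K m :=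
  [ffun S : {set 'I_m} => if a \in S then 0 else gsign K a S * x (toggle a S)].

Lemma dthetaE a x S :
  dtheta a x S = if a \in S then 0 else gsign K a S * x (toggle a S).
Proof. by rewrite ffunE. Qed.

Lemma dtheta_linear a : linear (dtheta a).
Proof.
move=> k x y; apply: gP => S; rewrite !(dthetaE, gE).
by case: ifP => _; rewrite ?mulr0 ?addr0 // mulrDr mulrCA.
Qed.
HB.instance Definition _ a :=
  GRing.isLinear.Build K (grassmann K m) (grassmann K m) _ (dtheta a) (dtheta_linear a).

Lemma dtheta_theta a b x :
  dtheta a (theta b * x) = (a == b)%:R *: x - theta b * dtheta a x.
Proof.
apply: gP => S; rewrite !(dthetaE, theta_mulE, gE) !in_toggle.
have [<-|ab] := eqVneq a b.
  rewrite mul1r addbT; case: (a \in S); rewrite /= ?oppr0 ?addr0 ?mulr0 ?subr0 //.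
    by rewrite toggleK gsign_toggle_id mulrA gsign_sqr mul1r subrr.
  by rewrite toggleK gsign_toggle_id mulrA gsign_sqr mul1r.
rewrite mul0r add0r !addbF.
case: (a \in S); case: (b \in S); rewrite ?mulr0 ?oppr0 //.
by rewrite !mulrA gsign_anticomm // mulNr toggleC.
Qed.

Lemma dtheta1 a : dtheta a 1 = 0.
Proof.
apply: gP => S; rewrite !(dthetaE, gE); case: ifPn => // aS.
by rewrite toggle_notin // -subset0 subUset sub1set inE mulr0.
Qed.

End GrassmannCalculus.

(** * Quadratic exponentials and the quadratic relations *)

Section Quadratic.
Variables (K : numFieldType) (m : nat).
Implicit Types (a b : 'I_m) (S T : {set 'I_m}) (x y z : grassmann K m).
Local Notation theta := (theta K).

Definition geven x := forall S, odd #|S| -> x S = 0.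
Definition vanishes_below k x := forall S, (#|S| < k)%N -> x S = 0.

(** These are the coordinates of the operator sum_a (theta_a (x) d_a + d_a (x) theta_a) applied to x
    (x) x. *)
Definition plucker x := forall S T,
  \sum_a ((theta a * x) S * dtheta a x T + dtheta a x S * (theta a * x) T) = 0.

Definition linear_form (u : 'I_m -> K) : grassmann K m := \sum_a u a *: theta a.
Definition quadratic_form (M : 'M[K]_m) : grassmann K m :=
  \sum_a \sum_b M a b *: (theta a * theta b).

Lemma theta_mul_quad a M :
  theta a * quadratic_form M = quadratic_form M * theta a.
Proof.
rewrite mulr_sumr mulr_suml; apply: eq_bigr => b _.
rewrite mulr_sumr mulr_suml; apply: eq_bigr => c _.
rewrite -scalerAr -scalerAl; congr (_ *: _).
rewrite mulrA (theta_anticomm K a b) mulNr -!mulrA.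
by rewrite (theta_anticomm K a c) mulrN opprK.
Qed.

Lemma linear_mul_quad u M :
  linear_form u * quadratic_form M = quadratic_form M * linear_form u.
Proof.
rewrite [LHS]mulr_suml [RHS]mulr_sumr; apply: eq_bigr => a _.
by rewrite -scalerAr -scalerAl theta_mul_quad.
Qed.

(** Passing two generators costs two signs, so the derivative reaches [x] unsigned. Since [a] may be
    either factor of a product, the linear form carries [M a b - M b a]. *)
Lemma dtheta_quad_mul a M x : dtheta a (quadratic_form M * x) =
  linear_form (fun b => M a b - M b a) * x + quadratic_form M * dtheta a x.
Proof.
rewrite !mulr_suml raddf_sum /=.
transitivity (\sum_b \sum_c M b c *: ((a == b)%:R *: (theta c * x)
   - (a == c)%:R *: (theta b * x) + theta b * (theta c * dtheta a x))).
  apply: eq_bigr => b _; rewrite mulr_suml raddf_sum; apply: eq_bigr => c _ /=.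
  rewrite -scalerAl linearZ /= -mulrA !dtheta_theta mulrBr -scalerAr opprB.
  by rewrite addrA addrAC.
under [LHS]eq_bigr => b _ do under eq_bigr => c _ do rewrite scalerDr scalerBr.
under [LHS]eq_bigr do rewrite big_split /= sumrB.
rewrite big_split /= sumrB; congr (_ + _).
  under [RHS]eq_bigr do rewrite scalerBl mulrBl -!scalerAl.
  rewrite sumrB; congr (_ - _).
    rewrite (bigD1 a) //= [X in _ + X]big1 ?addr0 => [|b /negPf ba].
      by apply: eq_bigr => c _; rewrite eqxx scale1r.
    by apply: big1 => c _; rewrite eq_sym ba scale0r scaler0.
  apply: eq_bigr => b _; rewrite (bigD1 a) //= big1 ?addr0 => [|c /negPf ca].
    by rewrite eqxx scale1r.
  by rewrite eq_sym ca scale0r scaler0.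
apply: eq_bigr => b _; rewrite mulr_suml; apply: eq_bigr => c _.
by rewrite -scalerAl mulrA.
Qed.

Lemma vanishes_below_theta a k x : vanishes_below k x -> vanishes_below k.+1 (theta a * x).
Proof.
move=> lx S Sk; rewrite theta_mulE; case: ifP => // aS.
by rewrite lx ?mulr0 // toggle_in //; move: Sk; rewrite (cardsD1 a) aS.
Qed.

Lemma vanishes_below_sum k I (r : seq I) (P : pred I) (F : I -> grassmann K m) :
  (forall i, P i -> vanishes_below k (F i)) -> vanishes_below k (\sum_(i <- r | P i) F i).
Proof. by move=> lF S Sk; rewrite gE_sum big1 // => i Pi; rewrite lF. Qed.

Lemma vanishes_below_scale k c x : vanishes_below k x -> vanishes_below k (c *: x).
Proof. by move=> lx S Sk; rewrite gscaleE lx ?mulr0. Qed.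

Lemma vanishes_below_linear u k x : vanishes_below k x ->
  vanishes_below k.+1 (linear_form u * x).
Proof.
move=> lx; rewrite mulr_suml; apply: vanishes_below_sum => a _.
by rewrite -scalerAl; apply/vanishes_below_scale/vanishes_below_theta.
Qed.

Lemma vanishes_below_quad M k x : vanishes_below k x ->
  vanishes_below k.+2 (quadratic_form M * x).
Proof.
move=> lx; rewrite mulr_suml; apply: vanishes_below_sum => a _; rewrite mulr_suml.
apply: vanishes_below_sum => b _.
by rewrite -scalerAl -mulrA;
  apply/vanishes_below_scale/vanishes_below_theta/vanishes_below_theta.
Qed.

Lemma vanishes_below_quadX M k : vanishes_below k.*2 (quadratic_form M ^+ k).
Proof.
elim: k => [|k IHk]; first by move=> S.
by rewrite exprS doubleS; apply: vanishes_below_quad.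
Qed.

Lemma geven_theta2 a b x : geven x -> geven (theta a * (theta b * x)).
Proof.
move=> ex S oS; rewrite !theta_mulE; case: ifP => // _; case: ifP => _.
  by rewrite ex ?mulr0 // !odd_toggle negbK.
by rewrite mulr0.
Qed.

Lemma geven_sum I (r : seq I) (P : pred I) (F : I -> grassmann K m) :
  (forall i, P i -> geven (F i)) -> geven (\sum_(i <- r | P i) F i).
Proof. by move=> eF S oS; rewrite gE_sum big1 // => i Pi; rewrite eF. Qed.

Lemma geven_scale c x : geven x -> geven (c *: x).
Proof. by move=> ex S oS; rewrite gscaleE ex ?mulr0. Qed.

Lemma geven1 : geven 1.
Proof. by move=> S; rewrite gE1; case: eqP => // ->; rewrite cards0. Qed.

Lemma geven_quadX M k : geven (quadratic_form M ^+ k).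
Proof.
elim: k => [|k IHk]; first exact: geven1.
rewrite exprS mulr_suml; apply: geven_sum => a _; rewrite mulr_suml.
apply: geven_sum => b _; rewrite -scalerAl -mulrA.
exact/geven_scale/geven_theta2.
Qed.

Lemma geven_gexp M : geven (gexp (quadratic_form M)).
Proof. by apply: geven_sum => k _; apply/geven_scale/geven_quadX. Qed.

(** Linear forms commute with the quadratic form, so the ordinary power rule holds; at [k = 0] the
    coefficient [k%:R] cancels the term with [k.-1]. *)
Lemma dtheta_quadX a M k : dtheta a (quadratic_form M ^+ k) =
  k%:R *: (linear_form (fun b => M a b - M b a) * quadratic_form M ^+ k.-1).
Proof.
elim: k => [|k IHk]; first by rewrite expr0 dtheta1 scale0r.
rewrite exprS dtheta_quad_mul IHk -scalerAr mulrA -linear_mul_quad -mulrA.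
case: k {IHk} => [|k] /=; first by rewrite scale0r addr0 scale1r.
by rewrite -exprS -[in RHS]natr1 scalerDl scale1r addrC.
Qed.

Lemma dtheta_gexp a M : dtheta a (gexp (quadratic_form M)) =
  linear_form (fun b => M a b - M b a) * gexp (quadratic_form M).
Proof.
set l := linear_form _; rewrite raddf_sum mulr_sumr big_ord_recl big_ord_recr /=.
rewrite expr0 linearZ /= dtheta1 scaler0 add0r.
(* Truncation leaves one unmatched term, of power [m]; times a linear form it starts in degree
   [2m + 1], beyond the [m] generators. *)
rewrite [X in _ = _ + X](_ : _ = 0) ?addr0; last first.
  apply: gP => S; rewrite -scalerAr gscaleE (vanishes_below_linear _
    (@vanishes_below_quadX M m)) ?mulr0 ?gE0 //.
  by rewrite ltnS (leq_trans (max_card _)) // card_ord -addnn leq_addr.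
apply: eq_bigr => k _; rewrite linearZ /= dtheta_quadX -scalerAr scalerA.
congr (_ *: _); rewrite /bump /= add1n factS natrM invfM mulrC mulrA.
by rewrite divff ?mul1r // pnatr_eq0.
Qed.

(** Substituting the derivatives turns both halves into double sums over [N]; exchanging [a] and [b]
    in one of them makes the antisymmetry of [N] cancel the other. *)
Lemma plucker_dtheta x (N : 'M[K]_m) : N^T = - N ->
  (forall a, dtheta a x = linear_form (N a) * x) -> plucker x.
Proof.
move=> Nasym dx S T.
pose F a b := N a b * ((theta a * x) S * (theta b * x) T).
have dE a U : dtheta a x U = \sum_b N a b * (theta b * x) U.
  rewrite dx mulr_suml gE_sum; apply: eq_bigr => b _.
  by rewrite -scalerAl gscaleE.
rewrite big_split /=.
rewrite [X in X + _](_ : _ = \sum_a \sum_b F a b); last first.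
  by apply: eq_bigr => a _; rewrite dE mulr_sumr; apply: eq_bigr => b _; rewrite mulrCA.
rewrite [X in _ + X](_ : _ = \sum_a \sum_b F b a *- 1) ?mulr1n; last first.
  apply: eq_bigr => a _; rewrite dE mulr_suml; apply: eq_bigr => b _.
  rewrite /F -mulrA -mulNr; congr (_ * _).
  by move/matrixP/(_ a b): Nasym; rewrite !mxE => ->; rewrite opprK.
rewrite [X in _ + X]exchange_big /= -big_split big1 // => a _.
by rewrite -big_split big1 // => b _; rewrite /= mulr1n subrr.
Qed.

Lemma plucker_gexp M : plucker (gexp (quadratic_form M)).
Proof.
apply: (@plucker_dtheta _ (M - M^T)) => [|a].
  by rewrite linearB /= trmxK opprB.
by rewrite dtheta_gexp /linear_form; congr (_ * _); apply: eq_bigr => b _; rewrite !mxE.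
Qed.

Lemma plucker_scale c x : plucker x -> plucker (c *: x).
Proof.
move=> px S T.
rewrite -[RHS](mulr0 (c ^+ 2)) -[X in _ = _ * X](px S T) mulr_sumr; apply: eq_bigr => a _.
by rewrite -!scalerAr linearZ /= !gscaleE; ring.
Qed.

Lemma gexp_quad0 M : gexp (quadratic_form M) set0 = 1.
Proof.
rewrite gE_sum big_ord_recl big1 ?addr0 => [|k _].
  by rewrite gscaleE gE1 eqxx invr1 mulr1.
by rewrite gscaleE vanishes_below_quadX ?mulr0 // cards0.
Qed.

Lemma dtheta_gexp1 a b M :
  dtheta a (gexp (quadratic_form M)) [set b] = M a b - M b a.
Proof.
have tb : toggle b [set b] = set0 by rewrite toggle_in ?set11 // setDv.
rewrite dtheta_gexp mulr_suml gE_sum (bigD1 b) //= [X in _ + X]big1 => [|c cb].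
  rewrite -scalerAl gscaleE theta_mulE set11 -(gsign_toggle_id K b) tb gsign_set0.
  by rewrite gexp_quad0 !mulr1 addr0.
by rewrite -scalerAl gscaleE theta_mulE inE (negPf cb) mulr0.
Qed.

Lemma plucker_eq x y : geven x -> geven y -> plucker x -> plucker y ->
  x set0 != 0 -> x set0 = y set0 ->
  (forall a b, dtheta a x [set b] = dtheta a y [set b]) -> x = y.
Proof.
move=> ex ey px py x0 xy0 xy2; apply: gP => S.
have [k] := ubnP #|S|; elim: k S => // k IHk S /ltnSE leSk.
have [oS|eS] := boolP (odd #|S|); first by rewrite ex ?ey.
have [->//|[a aS]] := set_0Vmem S.
have sgI c T (u v : K) : gsign K c T * u = gsign K c T * v -> u = v.
  by move/(congr1 ( *%R (gsign K c T))); rewrite !mulrA gsign_sqr !mul1r.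
(* In the relation at [S :\ a] and [[set a]], the left side is [z S * z set0] up to sign. The right
   side involves only [S] with two elements removed and coordinates of degree 2. *)
have rec z : plucker z -> dtheta a z (S :\ a) * (theta a * z) [set a] =
    - \sum_(b | b != a) (theta b * z) (S :\ a) * dtheta b z [set a].
  move=> /(_ (S :\ a) [set a]); rewrite (bigD1 a) //= theta_mulE !inE eqxx /= mul0r add0r.
  move/eqP; rewrite addr_eq0 => /eqP->; congr (- _); apply: eq_bigr => b ba.
  by rewrite (theta_mulE _ _ [set a]) inE (negPf ba) mulr0 addr0.
have : dtheta a x (S :\ a) * (theta a * x) [set a] =
       dtheta a y (S :\ a) * (theta a * y) [set a].
  rewrite !rec //; congr (- _); apply: eq_bigr => b ba; rewrite xy2; congr (_ * _).
  rewrite !theta_mulE; case: ifP => // bS; congr (_ * _); apply: IHk.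
  rewrite toggle_in //; apply: leq_trans leSk.
  by rewrite [in leqRHS](cardsD1 a) aS [in leqRHS](cardsD1 b) bS.
have ta : toggle a [set a] = set0 by rewrite toggle_in ?set11 // setDv.
have tS : toggle a (S :\ a) = S by rewrite toggle_notin ?setD1K // !inE eqxx.
rewrite !dthetaE !theta_mulE !inE eqxx /= ta tS xy0 !mulrA.
move/mulIf; rewrite -xy0 => /(_ x0); rewrite -!mulrA ![_ * gsign K a [set a]]mulrC !mulrA.
by rewrite -!mulrA => /sgI/sgI.
Qed.

Lemma plucker_gexpE x : geven x -> plucker x -> x set0 != 0 ->
  (* The derivative of the exponential has coordinates [N a b - N b a], which is [2 * N a b]: hence
     the factor 1/2. Dividing by [x set0] normalizes the constant term. *)
  exists N : 'M[K]_m, N^T = - N /\ x = x set0 *: gexp (quadratic_form N).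
Proof.
move=> ex px x0; pose N := \matrix_(a, b) ((x set0)^-1 / 2 * dtheta a x [set b]).
have Nasym : N^T = - N.
  apply/matrixP => a b; rewrite !mxE -mulrN; congr (_ * _).
  rewrite !dthetaE !inE eq_sym; case: eqP => [_|/eqP ab]; first by rewrite oppr0.
  have tb : toggle b [set a] = [set a; b].
    by rewrite toggle_notin ?inE 1?eq_sym // setUC.
  have ta : toggle a [set b] = [set a; b] by rewrite toggle_notin ?inE.
  have := gsign_anticomm K set0 ab.
  rewrite !gsign_set0 !mul1r [toggle a _]toggle_notin ?inE // [toggle b _]toggle_notin
    ?inE //.
  by rewrite !setU0 ta tb => ->; rewrite mulNr.
exists N; split=> //; apply: plucker_eq => // [|||a b].
- exact/geven_scale/geven_gexp.
- exact/plucker_scale/plucker_gexp.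
- by rewrite gscaleE gexp_quad0 mulr1.
rewrite linearZ gscaleE /= dtheta_gexp1.
have -> : N b a = - N a b by move/matrixP/(_ a b): Nasym; rewrite !mxE.
rewrite !mxE; field.
by rewrite x0.
Qed.

End Quadratic.

(** * Clifford monomials and the Grassmann representation *)

Lemma cmonomialU1 (C : numClosedFieldType) (m d : nat) (c : 'I_m -> 'M[C]_d)
    (a : 'I_m) (S : {set 'I_m}) : (forall b, b \in S -> (a < b)%N) ->
  cmonomial c (a |: S) = c a *m cmonomial c S.
Proof.
move=> aS; rewrite /cmonomial -big_filter -[in RHS]big_filter.
have e_sorted : sorted (fun a b : 'I_m => (a < b)%N) (index_enum 'I_m).
  rewrite /index_enum; case: index_enum_key => /=.
  by have := iota_ltn_sorted 0 m; rewrite -val_enum_ord sorted_map -enumT.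
have tr_lt : transitive (fun a b : 'I_m => (a < b)%N) by move=> ? ? ?; exact: ltn_trans.
suff -> : [seq i <- index_enum 'I_m | i \in a |: S] =
   a :: [seq i <- index_enum 'I_m | i \in S] by rewrite big_cons.
apply: (irr_sorted_eq tr_lt) => [b|||b].
- exact: ltnn.
- exact: sorted_filter.
- rewrite /= path_sortedE // sorted_filter // andbT; apply/allP => b.
  by rewrite mem_filter => /andP[/aS].
- by rewrite inE !mem_filter !mem_index_enum !andbT !inE.
Qed.

Lemma cmonomial0 (C : numClosedFieldType) (m d : nat) (c : 'I_m -> 'M[C]_d) :
  cmonomial c set0 = 1%:M.
Proof. by rewrite /cmonomial big_set0. Qed.

Section Monomials.
Variables (C : numClosedFieldType) (m d : nat) (c : 'I_m -> 'M[C]_d).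
Hypothesis cc : forall a b, c a *m c b + c b *m c a = (2 * (a == b)%:R)%:M.
Implicit Types (a b : 'I_m) (S T : {set 'I_m}) (f g : {set 'I_m} -> C).
Local Notation cm := (cmonomial c).

Lemma generator_sqr a : c a *m c a = 1%:M.
Proof.
apply: (@scalerI _ _ (2 : C)); first by rewrite pnatr_eq0.
by rewrite scaler_nat mulr2n cc eqxx mulr1 scalemx1.
Qed.

Lemma generator_anticomm a b : a != b -> c a *m c b = - (c b *m c a).
Proof.
by move=> /negPf ab; apply/eqP; rewrite -addr_eq0 cc ab mulr0 raddf0.
Qed.

Lemma gsign_le a S : (forall b, b \in S -> (a <= b)%N) -> gsign C a S = 1.
Proof.
move=> aS; rewrite /gsign /inversions big_set1 big1 ?expr0 // => b /aS.
by rewrite ltnNge => ->.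
Qed.

(** Left multiplication by [c a] acts as theta_a + d_a. Compare [a] with the least element [b] of
    the set: if smaller it is prepended, if equal the squares cancel, if larger it anticommutes past
    [c b]. *)
Lemma mul_generator_monomial a S : c a *m cm S = gsign C a S *: cm (toggle a S).
Proof.
elim/ord_set_ind: S => [|b S bS IHS].
  by rewrite cmonomial0 mulmx1 gsign_set0 scale1r toggle_notin ?inE // cmonomialU1 =>
    [|b]; rewrite ?inE // cmonomial0 mulmx1.
have bnS : b \notin S by apply/negP => /bS; rewrite ltnn.
rewrite cmonomialU1 //; case: (ltngtP a b) => [ab|ba|/val_inj ab].
- have lta e : e \in b |: S -> (a < e)%N.
    by rewrite !inE => /predU1P[->//|/bS]; apply: ltn_trans.
  rewrite gsign_le => [|e /lta/ltnW //]; rewrite scale1r toggle_notin; last first.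
    by apply/negP => /lta; rewrite ltnn.
  by rewrite !cmonomialU1.
- have nab : a != b by apply: contraTneq ba => ->; rewrite ltnn.
  rewrite mulmxA generator_anticomm // mulNmx -mulmxA IHS -scalemxAr -cmonomialU1.
    rewrite -[b |: S]toggle_notin // gsign_toggle ba expr1 mulN1r scaleNr toggleC.
    by rewrite (@toggle_notin _ b (toggle a S)) // in_toggle (negPf bnS) eq_sym (negPf nab).
  move=> e; rewrite in_toggle; case: eqP => [->//|_]; rewrite addbF; exact: bS.
rewrite ab mulmxA generator_sqr mul1mx toggle_in ?setU11 // setU1K //.
by rewrite gsign_le ?scale1r // => e; rewrite !inE => /predU1P[->//|/bS/ltnW].
Qed.

(** Each factor of the monomial contributes a sign, except [c a] itself, which commutes. *)
Lemma mul_monomial_generator a S :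
  cm S *m c a = (-1) ^+ (#|S| + (a \in S)) *: (c a *m cm S).
Proof.
elim/ord_set_ind: S => [|b S bS IHS].
  by rewrite cmonomial0 mulmx1 mul1mx cards0 inE expr0 scale1r.
have bnS : b \notin S by apply/negP => /bS; rewrite ltnn.
rewrite cmonomialU1 // -mulmxA IHS -scalemxAr !mulmxA cardsU1 bnS inE.
have [->|ab] := eqVneq a b.
  rewrite (negPf bnS) /=; congr (_ *: _).
  by rewrite -[LHS]signr_odd -[RHS]signr_odd !oddD /= set11; case: odd.
have ba : b != a by rewrite eq_sym.
rewrite in_set1 (negPf ab) (generator_anticomm ba).
by rewrite mulNmx scalerN -scaleNr add1n addSn exprS mulN1r.
Qed.

Definition comb f : 'M[C]_d := \sum_(S : {set 'I_m}) f S *: cm S.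

Lemma mul_generator_comb a f :
  c a *m comb f = comb (fun S => gsign C a S * f (toggle a S)).
Proof.
rewrite /comb mulmx_sumr [RHS](reindex_inj (inv_inj (toggleK a))) /=.
apply: eq_bigr => S _; rewrite toggleK gsign_toggle_id -scalemxAr.
by rewrite mul_generator_monomial scalerA mulrC.
Qed.

(** Right multiplication acts as theta_a - d_a on even elements: the parity of the set drops out,
    and membership of [a] is reversed on the toggled set, whence [a \notin S]. *)
Lemma mul_comb_generator a f : (forall S, odd #|S| -> f S = 0) ->
  comb f *m c a =
  comb (fun S => (-1) ^+ (a \notin S) * (gsign C a S * f (toggle a S))).
Proof.
move=> ef; rewrite /comb mulmx_suml [RHS](reindex_inj (inv_inj (toggleK a))) /=.
apply: eq_bigr => S _;
  rewrite toggleK gsign_toggle_id -scalemxAl in_toggle eqxx addbT negbK.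
rewrite mul_monomial_generator mul_generator_monomial !scalerA.
have [oS|eS] := boolP (odd #|S|); first by rewrite ef // !(mul0r, mulr0).
rewrite exprD -signr_odd (negPf eS) expr0; congr (_ *: _); ring.
Qed.

(** Some [c a] anticommutes with the monomial, and conjugation by it preserves the trace while
    negating the monomial. For even nonempty [S] any [a] in [S] works; for odd [S] any [a] outside,
    which exists because [m] is even. *)
Lemma trace_monomial S : ~~ odd m -> S != set0 -> \tr (cm S) = 0.
Proof.
move=> em S0.
suff [a aS] : exists a, odd #|S| != (a \in S).
  have /(congr1 (fun X => \tr (c a *m X))) := mul_monomial_generator a S.
  rewrite mxtrace_mulC -mulmxA generator_sqr mulmx1.
  rewrite -scalemxAr mulmxA generator_sqr mul1mx -signr_odd oddD oddb.
  rewrite -negb_eqb aS expr1 scaleN1r raddfN => /eqP.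
  by rewrite -addr_eq0 -mulr2n mulrn_eq0 => /eqP.
have [oS|eS] := boolP (odd #|S|); last by case/set0Pn: S0 => a aS; exists a; rewrite aS.
suff : ~~ [forall a, a \in S] by case/forallPn => a aS; exists a; rewrite (negPf aS).
apply: contra em => /forallP allS; rewrite -(card_ord m) -cardsT.
by have -> : [set: 'I_m] = S by apply/setP => a; rewrite allS inE.
Qed.

Lemma trace_comb f : ~~ odd m -> \tr (comb f) = d%:R * f set0.
Proof.
move=> em; rewrite raddf_sum (bigD1 set0) //= big1 => [|S S0].
  by rewrite linearZ /= cmonomial0 mxtrace1 addr0 mulrC.
by rewrite linearZ /= trace_monomial ?mulr0.
Qed.

(** The trace reads off the coefficient at [set0]; multiplying by [c a] with [a] in [S] moves the
    coefficient at [S] to the smaller set [S :\ a]. *)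
Lemma comb_eq0 f : ~~ odd m -> (0 < d)%N -> comb f = 0 -> forall S, f S = 0.
Proof.
move=> em d0 f0 S; have [k] := ubnP #|S|; elim: k S f f0 => // k IHk S f f0 leSk.
have [->|[a aS]] := set_0Vmem S.
  move/(congr1 mxtrace)/eqP: f0; rewrite trace_comb // raddf0 mulf_eq0.
  by rewrite pnatr_eq0 eqn0Ngt d0 => /eqP.
have := IHk (S :\ a) (fun S => gsign C a S * f (toggle a S)).
rewrite -mul_generator_comb f0 mulmx0 => /(_ erefl).
rewrite toggle_notin ?setD11 // setD1K // /gsign => H.
have {H} : (-1) ^+ inversions [set a] (S :\ a) * f S = 0.
  by apply: H; move: leSk; rewrite (cardsD1 a) aS.
by move/eqP; rewrite mulf_eq0 signr_eq0 => /eqP.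
Qed.

End Monomials.

(** Changes coordinates in both tensor factors at once. It is applied in both directions between
    matrix entries and monomial coordinates. *)
Lemma bilinear_sum_transfer (R : comNzRingType) (I J U V : finType)
    (x : I -> U -> R) (y : I -> V -> R) (x' : J -> U -> R) (y' : J -> V -> R)
    (s : U -> R) (t : V -> R) :
  (forall u v, \sum_i x i u * y i v = \sum_j x' j u * y' j v) ->
  \sum_i (\sum_u x i u * s u) * (\sum_v y i v * t v) =
  \sum_j (\sum_u x' j u * s u) * (\sum_v y' j v * t v).
Proof.
have main (L : finType) (z : L -> U -> R) (w : L -> V -> R) :
    \sum_i (\sum_u z i u * s u) * (\sum_v w i v * t v) =
    \sum_u \sum_v s u * t v * \sum_i z i u * w i v.
  transitivity (\sum_i \sum_u \sum_v s u * t v * (z i u * w i v)).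
    apply: eq_bigr => i _; rewrite mulr_suml; apply: eq_bigr => u _.
    by rewrite mulr_sumr; apply: eq_bigr => v _; ring.
  rewrite exchange_big; apply: eq_bigr => u _; rewrite exchange_big.
  by apply: eq_bigr => v _; rewrite mulr_sumr.
by move=> E; rewrite !main; apply: eq_bigr => u _; apply: eq_bigr => v _; rewrite E.
Qed.

(** * Monomial coordinates of operators and commutation with Lambda *)

Section Representation.
Variables (C : numClosedFieldType) (n : nat) (c : 'I_n.*2 -> 'M[C]_(2 ^ n)).
Hypothesis cc : forall a b, c a *m c b + c b *m c a = (2 * (a == b)%:R)%:M.
Local Notation rep := (grassmann_rep c).
Implicit Types (a b : 'I_n.*2) (S T : {set 'I_n.*2}) (X Y : 'M[C]_(2 ^ n)).

(** The monomials are independent, and their number 2^(2n) is the dimension (2^n)^2. *)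
Lemma cmonomials_basis : basis_of fullv (cmonomials c).
Proof.
rewrite basisEfree subvf; apply/and3P; split=> //.
  apply/freeP => k; pose f S := k (enum_rank S).
  have : (~~ odd n.*2) by rewrite odd_double.
  move=> em kE i; rewrite -(enum_valK i) -/(f _).
  apply: (comb_eq0 cc em); first by rewrite expn_gt0.
  rewrite -[RHS]kE /comb (reindex _ (onW_bij _ (@enum_val_bij _))) /=.
  by apply: eq_bigr => j _; rewrite /f enum_valK nth_mktuple.
rewrite size_tuple dimvf /dim /= -cardsT -powersetT card_powerset cardsT card_ord.
by rewrite -addnn expnD.
Qed.

Lemma rep_linear : linear rep.
Proof.
move=> k X Y; rewrite /grassmann_rep scaler_sumr -big_split; apply: eq_bigr => i _ /=.
by rewrite linearP /= scalerDl scalerA.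
Qed.
HB.instance Definition _ :=
  GRing.isLinear.Build C 'M[C]_(2 ^ n) (grassmann C n.*2) _ rep rep_linear.

Lemma rep_monomial S : rep (cmonomial c S) = gmonomial C S.
Proof.
have /andP[_ cfree] := cmonomials_basis.
have -> : cmonomial c S = (cmonomials c)`_(enum_rank S) by rewrite nth_mktuple enum_rankK.
rewrite /grassmann_rep (bigD1 (enum_rank S)) //= [X in _ + X]big1 => [|i iS].
  by rewrite coord_free // eqxx scale1r addr0 enum_rankK gmonomial_prod.
rewrite coord_free //; have -> : (enum_rank S == i) = false by rewrite eq_sym (negPf iS).
by rewrite scale0r.
Qed.

Lemma rep_comb f S : rep (comb c f) S = f S.
Proof.
rewrite linear_sum /= gE_sum (bigD1 S) //= big1 => [|T TS].
  by rewrite linearZ /= gscaleE rep_monomial ffunE eqxx mulr1 addr0.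
by rewrite linearZ /= gscaleE rep_monomial ffunE eq_sym (negPf TS) mulr0.
Qed.

Lemma comb_rep X : comb c (rep X) = X.
Proof.
have := coord_basis cmonomials_basis (memvf X) => XE.
suff [f ->] : exists f, X = comb c f.
  by set r := rep _; rewrite /comb; apply: eq_bigr => S _; rewrite /r rep_comb.
exists (fun S => coord (cmonomials c) (enum_rank S) X).
rewrite [LHS]XE /comb [RHS](reindex _ (onW_bij _ (@enum_val_bij _))) /=.
by apply: eq_bigr => j _; rewrite enum_valK nth_mktuple.
Qed.

Lemma rep_generatorl a X S : rep (c a *m X) S = gsign C a S * rep X (toggle a S).
Proof. by rewrite -{1}[X]comb_rep mul_generator_comb // rep_comb. Qed.

Lemma rep_generatorr a X S : geven (rep X) ->
  rep (X *m c a) S = (-1) ^+ (a \notin S) * (gsign C a S * rep X (toggle a S)).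
Proof. by move=> eX; rewrite -{1}[X]comb_rep mul_comb_generator // rep_comb. Qed.

Lemma trace_rep X : \tr X = (2 ^ n)%:R * rep X set0.
Proof. by rewrite -{1}[X]comb_rep trace_comb // odd_double. Qed.

Lemma trace_eq0 X : (\tr X == 0) = (rep X set0 == 0).
Proof. by rewrite trace_rep mulf_eq0 pnatr_eq0 expn_eq0. Qed.

Lemma even_opP X : even_op c X <-> geven (rep X).
Proof.
split=> [[f ->] S oS|eX].
  rewrite linear_sum gE_sum big1 // => T eT.
  rewrite linearZ gscaleE /= rep_monomial ffunE; case: eqP => [eST|]; last by rewrite mulr0.
  by rewrite -eST oS in eT.
exists (rep X); rewrite -{1}[X]comb_rep /comb [RHS]big_mkcond; apply: eq_bigr => S _.
by case: ifPn => // /negPn oS; rewrite eX // scale0r.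
Qed.

Lemma rep_entries X S :
  rep X S = \sum_(p : 'I_(2 ^ n) * 'I_(2 ^ n)) X p.1 p.2 * rep (delta_mx p.1 p.2) S.
Proof.
rewrite {1}[X]matrix_sum_delta pair_bigA linear_sum gE_sum; apply: eq_bigr => p _.
by rewrite linearZ gscaleE.
Qed.

Lemma entries_rep X p q :
  X p q = \sum_(S : {set 'I_n.*2}) rep X S * cmonomial c S p q.
Proof.
by rewrite -{1}[X]comb_rep summxE; apply: eq_bigr => S _; rewrite mxE.
Qed.

Definition lambda_commuting X := commutator (Lambda c) (X *t X) = 0.

Lemma lambda_commuting_entries X : lambda_commuting X <->
  forall p q : 'I_(2 ^ n) * 'I_(2 ^ n),
    \sum_a (c a *m X) p.1 p.2 * (c a *m X) q.1 q.2 =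
    \sum_a (X *m c a) p.1 p.2 * (X *m c a) q.1 q.2.
Proof.
rewrite /lambda_commuting /commutator /Lambda mulmx_suml mulmx_sumr.
under eq_bigr do rewrite tensmx_mul; under [X in _ - X]eq_bigr do rewrite tensmx_mul.
split=> [/eqP|E].
  rewrite subr_eq0 => /eqP E p q.
  move/matrixP/(_ (mxtens_index (p.1, q.1)) (mxtens_index (p.2, q.2))): E.
  by rewrite !summxE; under eq_bigr do rewrite tensmxE;
    under [RHS]eq_bigr do rewrite tensmxE.
apply/eqP; rewrite subr_eq0; apply/eqP/matrixP => i j.
case: (mxtens_indexP i) => i0 i1; case: (mxtens_indexP j) => j0 j1.
rewrite !summxE; under eq_bigr do rewrite tensmxE; under [RHS]eq_bigr do rewrite tensmxE.
exact: (E (i0, j0) (i1, j1)).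
Qed.

Lemma lambda_commuting_rep X : lambda_commuting X <->
  forall S T, \sum_a rep (c a *m X) S * rep (c a *m X) T =
              \sum_a rep (X *m c a) S * rep (X *m c a) T.
Proof.
rewrite lambda_commuting_entries; split=> E => [S T|p q].
  under eq_bigr do rewrite (rep_entries _ S) (rep_entries _ T).
  under [RHS]eq_bigr do rewrite (rep_entries _ S) (rep_entries _ T).
  exact: (@bilinear_sum_transfer _ _ _ _ _
    (fun a p => (c a *m X) p.1 p.2) (fun a p => (c a *m X) p.1 p.2)).
under eq_bigr do rewrite (entries_rep _ p.1) (entries_rep _ q.1).
under [RHS]eq_bigr do rewrite (entries_rep _ p.1) (entries_rep _ q.1).
exact: (@bilinear_sum_transfer _ _ _ _ _ (fun a => rep (c a *m X)) (fun a =>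
  rep (c a *m X))).
Qed.

Lemma lambda_commuting_plucker X : geven (rep X) ->
  lambda_commuting X <-> plucker (rep X).
Proof.
move=> eX; rewrite lambda_commuting_rep.
(* With left and right multiplication acting as theta + d and theta - d, the difference of their
   tensor squares is 2 (theta (x) d + d (x) theta). *)
suff E S T : \sum_a rep (c a *m X) S * rep (c a *m X) T -
       \sum_a rep (X *m c a) S * rep (X *m c a) T =
    2 * \sum_a ((theta C a * rep X) S * dtheta a (rep X) T
               + dtheta a (rep X) S * (theta C a * rep X) T).
  split=> H S T; first by have /eqP := E S T;
    rewrite H subrr eq_sym mulf_eq0 pnatr_eq0 => /eqP.
  by apply/eqP; rewrite -subr_eq0 E H mulr0.
rewrite -sumrB mulr_sumr; apply: eq_bigr => a _.
rewrite !rep_generatorl !rep_generatorr // !theta_mulE !dthetaE.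
by case: (a \in S); case: (a \in T); rewrite /= ?expr0 ?expr1; ring.
Qed.

Lemma lambda_commutingM X Y :
  lambda_commuting X -> lambda_commuting Y -> lambda_commuting (X *m Y).
Proof.
rewrite /lambda_commuting /commutator => /subr0_eq EX /subr0_eq EY; apply/eqP.
by rewrite subr_eq0 -tensmx_mul mulmxA EX -mulmxA EY mulmxA.
Qed.

Lemma lambda_commuting_generator a : lambda_commuting (c a).
Proof.
apply/lambda_commuting_entries => p q; apply: eq_bigr => b _.
have [->//|ba] := eqVneq b a.
by rewrite generator_anticomm // !mxE mulrNN.
Qed.

(** The operator multiplies the pair [c a], [c b] on either side by a scaled plane rotation, so both
    sums restricted to the pair equal (1 + t^2) (c_a (x) c_a + c_b (x) c_b). The other generators
    commute with [c a *m c b]. *)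
Lemma lambda_commuting_pair a b t : a != b ->
  lambda_commuting (1%:M + t *: (c a *m c b)).
Proof.
move=> ab; have ba : b != a by rewrite eq_sym.
have la : c a *m (1%:M + t *: (c a *m c b)) = c a + t *: c b.
  by rewrite mulmxDr mulmx1 -scalemxAr mulmxA generator_sqr // mul1mx.
have lb : c b *m (1%:M + t *: (c a *m c b)) = c b - t *: c a.
  by rewrite mulmxDr mulmx1 -scalemxAr (generator_anticomm cc ab) mulmxN mulmxA
    generator_sqr // mul1mx scalerN.
have ra : (1%:M + t *: (c a *m c b)) *m c a = c a - t *: c b.
  by rewrite mulmxDl mul1mx -scalemxAl (generator_anticomm cc ab) mulNmx -mulmxA
    generator_sqr // mulmx1 scalerN.
have rb : (1%:M + t *: (c a *m c b)) *m c b = c b + t *: c a.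
  by rewrite mulmxDl mul1mx -scalemxAl -mulmxA generator_sqr // mulmx1.
apply/lambda_commuting_entries => p q.
rewrite (bigD1 a) // [RHS](bigD1 a) // (bigD1 b) // [X in _ = _ + X](bigD1 b) //=.
rewrite la lb ra rb !addrA; congr (_ + _); first by rewrite !mxE; ring.
apply: eq_bigr => e /andP[ea eb];
  suff -> : c e *m (1%:M + t *: (c a *m c b)) = (1%:M + t *: (c a *m c b)) *m c e by [].
rewrite mulmxDr mulmxDl mulmx1 mul1mx -scalemxAr -scalemxAl; congr (_ + _ *: _).
by rewrite mulmxA (generator_anticomm cc ea) mulNmx -!mulmxA (generator_anticomm cc eb)
  mulmxN opprK.
Qed.

End Representation.

(** * Gaussian operators as limits *)

Section Limits.
Variables (C : numClosedFieldType).

Lemma cvg_sum (V : normedModType C) (I : Type) (r : seq I)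
    (f : I -> nat -> V) (l : I -> V) :
  (forall i, (f i @ \oo --> l i)%classic) ->
  ((fun j => \sum_(i <- r) f i j) @ \oo --> \sum_(i <- r) l i)%classic.
Proof.
move=> fl; elim: r => [|i r IHr].
  rewrite big_nil (_ : (fun _ => _) = (fun=> 0)); first exact: cvg_cst.
  by apply/boolp.funext => j; rewrite big_nil.
rewrite big_cons (_ : (fun _ => _) = f i \+ (fun j => \sum_(i <- r) f i j)).
  exact: cvgD.
by apply/boolp.funext => j; rewrite big_cons.
Qed.

(** A linear map on matrices is a finite combination of the entries, and these are continuous. *)
Lemma cvg_linear (V : normedModType C) (p q : nat) (h : {linear 'M[C]_(p, q) -> V})
    (Y : nat -> 'M[C]_(p, q)) (X : 'M[C]_(p, q)) :
  (Y @ \oo --> X)%classic -> ((fun j => h (Y j)) @ \oo --> h X)%classic.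
Proof.
move=> YX.
have hE Z : h Z = \sum_(ij : 'I_p * 'I_q) Z ij.1 ij.2 *: h (delta_mx ij.1 ij.2).
  rewrite {1}[Z]matrix_sum_delta pair_bigA linear_sum; apply: eq_bigr => ij _.
  by rewrite linearZ.
rewrite hE (_ : (fun _ => _) = (fun j =>
  \sum_(ij : 'I_p * 'I_q) Y j ij.1 ij.2 *: h (delta_mx ij.1 ij.2)));
  last by apply/boolp.funext => j; rewrite hE.
apply: cvg_sum => ij; apply: cvgZr_tmp.
exact: (cvg_comp _ _ YX (@coord_continuous _ _ _ ij.1 ij.2 X)).
Qed.

Lemma cvg_inv_natS : (forall x : C, 0 < x -> exists N : nat, x < N%:R) ->
  ((fun j => (j.+1%:R)^-1) @ \oo --> (0 : C))%classic.
Proof.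
move=> arch; apply/cvgr0Pnorm_lt => e e0.
have [N ltN] : exists N : nat, e^-1 < N%:R by apply: arch; rewrite invr_gt0.
exists N => // j /= Nj.
rewrite normfV normr_nat -[e]invrK ltf_pV2 ?posrE ?invr_gt0 ?ltr0n //.
by apply: lt_trans ltN _; rewrite ltr_nat ltnS.
Qed.

End Limits.

(** * Equivalence of the Gaussian and commutation conditions *)

Section Gaussian.
Variables (C : numClosedFieldType) (n : nat) (c : 'I_n.*2 -> 'M[C]_(2 ^ n)).
Hypothesis cc : forall a b, c a *m c b + c b *m c a = (2 * (a == b)%:R)%:M.
Local Notation rep := (grassmann_rep c).
Implicit Types (a b : 'I_n.*2) (S T : {set 'I_n.*2}) (X Y : 'M[C]_(2 ^ n)).

Lemma exp_argE (M : 'M[C]_n.*2) :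
  ('i / 2) *: (\sum_a \sum_b M a b *: (theta C a * theta C b)) =
  quadratic_form (('i / 2) *: M).
Proof.
rewrite scaler_sumr; apply: eq_bigr => a _; rewrite scaler_sumr.
by apply: eq_bigr => b _; rewrite scalerA mxE.
Qed.

Lemma exp_form_plucker X : exp_form c X -> geven (rep X) /\ plucker (rep X).
Proof.
move=> [z [M [_ ->]]]; rewrite exp_argE; split.
  exact/geven_scale/geven_gexp.
exact/plucker_scale/plucker_gexp.
Qed.

Lemma plucker_exp_form X : geven (rep X) -> plucker (rep X) ->
  rep X set0 != 0 -> exp_form c X.
Proof.
move=> eX pX X0; have [N [Nasym XE]] := plucker_gexpE eX pX X0.
have iN0 : ('i / 2 : C) != 0 by rewrite mulf_neq0 ?neq0Ci ?invr_neq0 ?pnatr_eq0.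
exists (rep X set0), (('i / 2)^-1 *: N); split.
  by rewrite linearZ /= Nasym scalerN.
by rewrite {1}XE exp_argE scalerA divff ?scale1r.
Qed.

(** Evenness and the quadratic relations are polynomial equations in continuous coordinates, hence
    closed conditions. *)
Lemma plucker_limit (Y : nat -> 'M[C]_(2 ^ n)) X : (Y @ \oo --> X)%classic ->
  (forall j, geven (rep (Y j)) /\ plucker (rep (Y j))) ->
  geven (rep X) /\ plucker (rep X).
Proof.
move=> YX epY.
(* The target is written [C^o] so that a coordinate becomes a linear map into a normed module. *)
pose co S : 'M[C]_(2 ^ n) -> C^o := fun Z => rep Z S.
have co_lin S : linear (co S).
  by move=> k Z W; rewrite /co linearP !(gED, gscaleE).
pose coL S := HB.pack_for {linear 'M[C]_(2 ^ n) -> C^o} (co S)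
  (GRing.isLinear.Build _ _ _ _ (co S) (co_lin S)).
have cvg_co S : ((fun j => rep (Y j) S) @ \oo --> rep X S)%classic.
  exact: (@cvg_linear C C^o _ _ (coL S) _ _ YX).
have lim0 (f : nat -> C) l : (f @ \oo --> l)%classic -> (forall j, f j = 0) -> l = 0.
  move=> fl f0; apply: (@cvg_unique C _ (f @ \oo)%classic) => //.
  rewrite (_ : f = fun=> 0); last exact/boolp.funext.
  exact: cvg_cst.
have cvg_theta a S : ((fun j =>
  (theta C a * rep (Y j)) S) @ \oo --> (theta C a * rep X) S)%classic.
  rewrite theta_mulE (_ : (fun _ => _) = (fun j =>
    if a \in S then gsign C a S * rep (Y j) (toggle a S) else 0)); last first.
    by apply/boolp.funext => j; rewrite theta_mulE.
  case: ifP => _; last exact: cvg_cst.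
  by apply: cvgM; [exact: cvg_cst|].
have cvg_dtheta a S : ((fun j =>
  dtheta a (rep (Y j)) S) @ \oo --> dtheta a (rep X) S)%classic.
  rewrite dthetaE (_ : (fun _ => _) = (fun j =>
    if a \in S then 0 else gsign C a S * rep (Y j) (toggle a S))); last first.
    by apply/boolp.funext => j; rewrite dthetaE.
  case: ifP => _; first exact: cvg_cst.
  by apply: cvgM; [exact: cvg_cst|].
split=> [S oS|S T].
  by apply: lim0 (cvg_co S) _ => j; apply: (epY j).1.
pose F j a := (theta C a * rep (Y j)) S * dtheta a (rep (Y j)) T
             + dtheta a (rep (Y j)) S * (theta C a * rep (Y j)) T.
apply: (lim0 (fun j => \sum_a F j a)) => [|j]; last exact: (epY j).2.
apply: (@cvg_sum C C^o) => a.
by apply: cvgD; apply: cvgM.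
Qed.

(* Each factor lowers the minimal degree of the support by 2 when its pair lies
   in a minimal support set, and tends to the identity as t -> 0. *)
Fixpoint pair_rotate t (s : seq 'I_n.*2) X : 'M[C]_(2 ^ n) :=
  if s is a :: b :: s' then pair_rotate t s' ((1%:M + t *: (c a *m c b)) *m X) else X.

Lemma pair_rotate_cvg s (t : nat -> C) (Y : nat -> 'M[C]_(2 ^ n)) X :
  (t @ \oo --> (0 : C))%classic -> (Y @ \oo --> X)%classic ->
  ((fun j => pair_rotate (t j) s (Y j)) @ \oo --> X)%classic.
Proof.
move=> t0; have [k] := ubnP (size s); elim: k s Y => // k IHk [|a [|b s]] //= Y lek YX.
apply: IHk; first by apply: ltnW.
rewrite (_ : (fun _ => _) = Y \+ (fun j => t j *: (c a *m c b *m Y j))); last first.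
  by apply/boolp.funext => j; rewrite /= mulmxDl mul1mx -scalemxAl.
rewrite -[X in (_ --> X)%classic]addr0 -[in X in (_ --> X)%classic](scale0r (c a *m c b
  *m X)).
apply: cvgD => //; apply: cvgZ => //.
exact: (cvg_linear (h := mulmx (c a *m c b))).
Qed.

(** Invariant: the remaining list is a support set of minimal size. Two toggles add at most two
    elements, so minimality passes to the shortened list, and at the empty list the coordinate at
    [set0] is nonzero. *)
Lemma pair_rotate_spec t s X : t != 0 -> ~~ odd (size s) -> uniq s ->
  geven (rep X) -> lambda_commuting c X ->
  rep X [set a in s] != 0 -> (forall S, (#|S| < size s)%N -> rep X S = 0) ->
  [/\ geven (rep (pair_rotate t s X)), lambda_commuting c (pair_rotate t s X)
    & rep (pair_rotate t s X) set0 != 0].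
Proof.
move=> t0; have [k] := ubnP (size s);
  elim: k s X => // k IHk [|a [|b s]] //= X lek es us eX lX Xs Xlow.
move: us; rewrite !inE negb_or => /and3P[/andP[ab nas] nbs us].
have repE S : rep ((1%:M + t *: (c a *m c b)) *m X) S =
   rep X S + t * (gsign C a S * (gsign C b (toggle a S) * rep X (toggle b (toggle a S)))).
  by rewrite mulmxDl mul1mx -scalemxAl -mulmxA linearD linearZ gED gscaleE /=
    !rep_generatorl.
apply: IHk => //.
- by apply: ltnW.
- by rewrite negbK in es.
- by move=> S oS; rewrite repE !eX ?mulr0 ?addr0 // !odd_toggle negbK.
- exact: lambda_commutingM (lambda_commuting_pair cc t ab) lX.
(* The old coordinate at the shortened set vanishes by minimality, so the new one is [t] times the
   coordinate at the full set, up to sign. *)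
- rewrite repE Xlow ?add0r; last first.
    by rewrite cardsE (card_uniqP us).
  rewrite (_ : toggle b _ = [set e in a :: b :: s]).
    by rewrite !mulf_neq0 // signr_eq0.
  apply/setP => e; rewrite !in_toggle !inE.
  case: (eqVneq e a) => [->|ea]; first by rewrite (negPf ab) (negPf nas).
  by case: (eqVneq e b) => [->|eb]; rewrite ?(negPf nbs) ?addbF.
move=> S ltS; rewrite repE !Xlow ?mulr0 ?addr0 //; last by do 2 apply: leqW.
rewrite ltnS; apply: leq_trans (card_toggle_le _ _) _; rewrite ltnS.
exact: leq_trans (card_toggle_le _ _) _.
Qed.

Lemma minimal_support X : X != 0 ->
  exists B, rep X B != 0 /\ forall S, (#|S| < #|B|)%N -> rep X S = 0.
Proof.
move=> X0; have [S XS] : exists S, rep X S != 0.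
  apply/existsP; apply: contraNT X0; rewrite negb_exists => /forallP X0.
  rewrite -(comb_rep cc X) /comb big1 // => S _.
  by have /negPn/eqP -> := X0 S; rewrite scale0r.
case: (@arg_minnP _ S (fun S => rep X S != 0) (fun S => #|S|)) => // B XB minB.
exists B; split=> // T ltT; apply/eqP; apply: contraLR ltT => /minB.
by rewrite -leqNgt.
Qed.

Lemma lambda_commuting_exp_limit (t : nat -> C) X :
  (t @ \oo --> (0 : C))%classic -> (forall j, t j != 0) ->
  geven (rep X) -> lambda_commuting c X ->
  exists Y : nat -> 'M[C]_(2 ^ n),
    (forall j, \tr (Y j) != 0 /\ exp_form c (Y j)) /\ (Y @ \oo --> X)%classic.
Proof.
move=> t0 tn0 eX lX.
have spec Y : geven (rep Y) -> lambda_commuting c Y -> rep Y set0 != 0 ->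
    \tr Y != 0 /\ exp_form c Y.
  move=> eY lY Y0; split; first by rewrite (trace_eq0 cc).
  by apply: plucker_exp_form => //; apply/lambda_commuting_plucker.
(* The zero operator has no support set to start from; small multiples of the identity approach it
   instead. *)
have [->|X0] := eqVneq X 0.
  have rep1 : rep 1%:M = 1.
    by rewrite -(cmonomial0 c) rep_monomial //.
  exists (fun j => t j *: 1%:M); split=> [j|].
    apply: spec.
    - by rewrite linearZ /= rep1; apply/geven_scale/geven1.
    - apply/lambda_commuting_entries => p q; apply: eq_bigr => a _.
      by rewrite -scalemxAr -scalemxAl mulmx1 mul1mx.
    - by rewrite linearZ /= rep1 gscaleE gE1 eqxx mulr1.
  rewrite -[X in (_ --> X)%classic](scale0r 1%:M).
  exact: cvgZr_tmp.
have [B [XB minB]] := minimal_support X0.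
have eB : ~~ odd #|B| by apply: contra XB => oB; rewrite eX.
have BE : [set a in enum B] = B by apply/setP => a; rewrite inE mem_enum.
exists (fun j => pair_rotate (t j) (enum B) X); split=> [j|]; last first.
  by apply: pair_rotate_cvg => //; exact: cvg_cst.
case: (@pair_rotate_spec (t j) (enum B) X); rewrite ?enum_uniq ?BE -?cardE //;
  last exact: spec.
Qed.

Lemma gaussianP X : (forall x : C, 0 < x -> exists N : nat, x < N%:R) ->
  gaussian c X <-> even_op c X /\ lambda_commuting c X.
Proof.
move=> /cvg_inv_natS; set t := (fun j => _) => t0; rewrite even_opP //.
have tn0 j : t j != 0 by rewrite invr_eq0 pnatr_eq0.
have eqv Y : geven (rep Y) -> plucker (rep Y) -> geven (rep Y) /\ lambda_commuting c Y.
  by move=> eY pY; split=> //; apply/lambda_commuting_plucker.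
split=> [[[_ /exp_form_plucker[]]|[_ [Y [eY YX]]]]|[eX lX]]; first exact: eqv.
  have [|eX pX] := plucker_limit YX; last exact: eqv.
  by move=> j; apply: exp_form_plucker; case: (eY j).
have [X0|X0] := eqVneq (\tr X) 0; [right|left]; split=> //.
  exact: lambda_commuting_exp_limit t0 tn0 eX lX.
apply: plucker_exp_form => //; last by rewrite -(trace_eq0 cc).
exact/lambda_commuting_plucker.
Qed.

End Gaussian.

(** A positive element of [R[i]] has zero imaginary part, so the bound comes from [R]. *)
Lemma complex_archimedean (R : realType) (x : R[i]) :
  0 < x -> exists N : nat, x < N%:R.
Proof.
case: x => a b; rewrite ltcE /= => /andP[/eqP-> _].
exists (Num.bound `|a|); rewrite -(rmorph_nat (@real_complex R)) ltcE /= eqxx /=.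
exact: le_lt_trans (ler_norm a) (archi_boundP (normr_ge0 a)).
Qed.

(** * Canonical form *)

Section Projection.
Variables (K : comNzRingType) (m : nat) (P : {set 'I_m}).
Implicit Types (x y : grassmann K m).

(** This sets [theta a] to 0 for every [a] outside [P], hence is an algebra morphism. *)
Definition gproj x : grassmann K m :=
  [ffun S : {set 'I_m} => if S \subset P then x S else 0].

Lemma gprojE x S : gproj x S = if S \subset P then x S else 0.
Proof. by rewrite ffunE. Qed.

Lemma gproj_linear : linear gproj.
Proof.
move=> k x y; apply: gP => S; rewrite !(gprojE, gE).
by case: ifP => _; rewrite ?mulr0 ?addr0.
Qed.

Lemma gproj_monoid_morphism : monoid_morphism gproj.
Proof.
split=> [|x y]; apply: gP => S; rewrite gprojE ?gmulE ?gE1.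
  by case: ifPn => //; case: eqP => // ->; rewrite sub0set.
case: ifPn => SP.
  apply: eq_bigr => A AS; rewrite !gprojE (subset_trans AS SP).
  by rewrite (subset_trans (subsetDl _ _) SP).
rewrite big1 // => A AS; rewrite !gprojE.
case: (boolP (A \subset P)) => AP; last by rewrite mulr0 mul0r.
case: (boolP (S :\: A \subset P)) => DP; last by rewrite mulr0.
case/negP: SP; rewrite -(setID S A) subUset DP andbT.
exact: subset_trans (subsetIr _ _) AP.
Qed.

HB.instance Definition _ :=
  GRing.isLinear.Build K (grassmann K m) (grassmann K m) _ gproj gproj_linear.
HB.instance Definition _ :=
  GRing.isMonoidMorphism.Build (grassmann K m) (grassmann K m) gproj gproj_monoid_morphism.

Lemma gproj_theta a : gproj (theta K a) = if a \in P then theta K a else 0.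
Proof.
apply: gP => S; rewrite gprojE; case: ifPn => [SP|nSP].
  case: ifPn => // aP; rewrite !ffunE; case: eqP SP => // ->.
  by rewrite sub1set (negPf aP).
case: ifPn => [aP|]; rewrite ?ffunE //; case: eqP nSP => // ->.
by rewrite sub1set aP.
Qed.

End Projection.

Lemma gproj_gexp (K : numFieldType) (m : nat) (P : {set 'I_m}) (x : grassmann K m) :
  gproj P (gexp x) = gexp (gproj P x).
Proof.
by rewrite linear_sum; apply: eq_bigr => k _; rewrite linearZ /= rmorphXn.
Qed.

Lemma prod_enum (R : pzSemiRingType) (I : finType) (A : {set I}) (F : I -> R) :
  \prod_(i <- enum A) F i = \prod_(i in A) F i.
Proof.
by rewrite -[RHS]big_filter /index_enum; case: index_enum_key.
Qed.

(** * Linear forms that annihilate an element *)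

Section PureForm.
Variables (K : numFieldType) (m : nat).
Implicit Types (a b : 'I_m) (S T B : {set 'I_m}) (x y z : grassmann K m).
Local Notation theta := (theta K).

Lemma linear_form_anticomm u v :
  linear_form u * linear_form v = - (linear_form v * linear_form u) :> grassmann K m.
Proof.
rewrite /linear_form !big_distrlr exchange_big -sumrN; apply: eq_bigr => a _.
rewrite -sumrN; apply: eq_bigr => b _.
by rewrite /= -!scalerAl -!scalerAr !scalerA theta_anticomm scalerN mulrC.
Qed.

Lemma linear_form_sqr u : linear_form u * linear_form u = 0 :> grassmann K m.
Proof.
apply: gP => S; have /(congr1 (fun x : grassmann K m => x S)) := linear_form_anticomm u u.
by rewrite gEN gE0 => /eqP; rewrite -addr_eq0 -mulr2n mulrn_eq0 => /eqP.
Qed.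

Lemma linear_form_prod_eq0 (I : eqType) (u : I -> 'I_m -> K) (r : seq I) (i : I) :
  i \in r -> linear_form (u i) * \prod_(j <- r) linear_form (u j) = 0.
Proof.
elim: r => // j r IHr; rewrite inE big_cons => /predU1P[<-|/IHr ir].
  by rewrite mulrA linear_form_sqr mul0r.
by rewrite mulrA linear_form_anticomm mulNr -mulrA ir mulr0 oppr0.
Qed.

Lemma linear_form_prod_homogeneous (I : Type) (u : I -> 'I_m -> K) (r : seq I) S :
  #|S| != size r -> (\prod_(j <- r) linear_form (u j)) S = 0.
Proof.
elim: r S => [|j r IHr] S; first by rewrite big_nil gE1 cards_eq0 => /negPf->.
move=> Sr; rewrite big_cons mulr_suml gE_sum big1 // => a _.
rewrite -scalerAl gscaleE theta_mulE; case: ifP => aS; last by rewrite mulr0.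
rewrite IHr ?mulr0 // toggle_in //; apply: contra Sr => /eqP Sr.
by rewrite (cardsD1 a) aS Sr.
Qed.

Section Factor.
Variables (B : {set 'I_m}) (L : 'M[K]_m).
Hypothesis LB : forall a b, a \in B -> b \in B -> L b a = (b == a)%:R.
Local Notation nu := (fun b => linear_form (L b)).

(** Induction on the size of [B :\: S]. For [b] in it, the coordinate of [nu b * z] at [b |: S] is
    [z S] up to sign, plus coordinates at sets that contain one more element of [B]; [LB] removes
    the terms from the rest of [B]. *)
Lemma annihilated_eq0 z : (forall b, b \in B -> nu b * z = 0) ->
  (forall S, B \subset S -> z S = 0) -> z = 0.
Proof.
move=> nz zB; apply: gP => S; rewrite gE0.
have [k] := ubnP #|B :\: S|; elim: k S => // k IHk S leSk.
have [/zB //|/subsetPn[b bB bS]] := boolP (B \subset S).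
have /(congr1 (fun x : grassmann K m => x (b |: S))) := nz b bB.
rewrite gE0 mulr_suml gE_sum (bigD1 b) //= [X in _ + X]big1 => [|a ab]; last first.
  rewrite -scalerAl gscaleE theta_mulE; case: ifPn => [aS|]; last by rewrite mulr0.
  have [aB|aB] := boolP (a \in B); first by rewrite LB // eq_sym (negPf ab) mul0r.
  rewrite IHk ?mulr0 //; apply: leq_trans (_ : #|(B :\: S) :\ b|.+1 <= _)%N.
    rewrite ltnS; apply/subset_leq_card/subsetP => e; rewrite !inE in_toggle !inE.
    have [->|eb] := eqVneq e b; first by rewrite eq_sym (negPf ab).
    by have [->|ea] := eqVneq e a; rewrite ?(negPf aB) ?andbF ?addbF.
  by move: leSk; rewrite [#|B :\: S|](cardsD1 b) !inE bB bS.
rewrite addr0 -scalerAl gscaleE theta_mulE setU11 LB // eqxx mul1r -(toggle_notin bS)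
  toggleK.
by move/eqP; rewrite mulf_eq0 signr_eq0 => /eqP.
Qed.

(** Every [nu b] annihilates both sides, so it is enough to compare coordinates at sets containing
    [B]. *)
Lemma factor_linear_forms x y s :
  (forall b, b \in B -> nu b * x = 0) ->
  (forall S, ~~ (S \subset ~: B) -> y S = 0) ->
  (forall S, [disjoint B & S] -> y S = s * (-1) ^+ inversions B S * x (B :|: S)) ->
  s *: x = (\prod_(b <- enum B) nu b) * y.
Proof.
move=> nx ysupp yE; set w := \prod_(b <- _) _; apply/eqP; rewrite -subr_eq0; apply/eqP.
apply: annihilated_eq0 => [b bB|S BS].
  rewrite mulrBr -scalerAr nx // scaler0 mulrA linear_form_prod_eq0 ?mem_enum //.
  by rewrite mul0r subrr.
(* Killing the generators outside [B] turns each [nu b] into [theta b], and the product into the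
   monomial of [B]. *)
have wB : w B = 1.
  have : gproj B w = gmonomial K B.
    rewrite /w prod_enum rmorph_prod -gmonomial_prod; apply: eq_bigr => b bB.
    rewrite /= /linear_form linear_sum (bigD1 b) //= [X in _ + X]big1 => [|a ab].
      by rewrite linearZ /= gproj_theta bB LB // eqxx scale1r addr0.
    rewrite linearZ /= gproj_theta; case: ifP => aB; last by rewrite scaler0.
    by rewrite LB // eq_sym (negPf ab) scale0r.
  by move/(congr1 (fun x : grassmann K m => x B)); rewrite !ffunE subxx eqxx.
(* Only the splitting [A = B] survives: [w] is homogeneous of degree [#|B|], and any other [A] of
   that size leaves an element of [B] in [S :\: A], where [y] vanishes. *)
rewrite gED gEN gscaleE gmulE (bigD1 B) //= [X in _ - (_ + X)]big1 => [|A /andP[AS AB]];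
  last first.
  have [cAB|cAB] := eqVneq #|A| #|B|; last first.
    by rewrite linear_form_prod_homogeneous -?cardE // mulr0 mul0r.
  rewrite ysupp ?mulr0 //; apply: contra AB => /subsetP sub.
  rewrite eq_sym eqEcard cAB leqnn andbT; apply/subsetP => b bB.
  apply: contraT => bA; have : b \in ~: B by apply: sub; rewrite inE bA (subsetP BS).
  by rewrite inE bB.
rewrite wB mulr1 addr0 yE; last by rewrite -setI_eq0 setDE setICA setICr setI0.
have -> : B :|: S :\: B = S by rewrite -{1}(setIidPr BS) setID.
rewrite -!mulrA mulrCA (mulrA (_ ^+ _)) -expr2 sqrr_sign mul1r; exact: subrr.
Qed.

End Factor.

(** In the relation at [B :\ b] and [T] the products with [theta a] on the left involve [B] with two
    elements removed, so they vanish by minimality. *)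
Lemma plucker_annihilator x B b : plucker x ->
  (forall S, (#|S| < #|B|)%N -> x S = 0) -> b \in B ->
  linear_form (fun a => dtheta a x (B :\ b)) * x = 0.
Proof.
move=> px minB bB; apply: gP => T; rewrite mulr_suml gE_sum gE0.
rewrite -[RHS](px (B :\ b) T); apply: eq_bigr => a _.
rewrite -scalerAl gscaleE [X in _ = X * _ + _](_ : _ = 0) ?mul0r ?add0r //.
rewrite theta_mulE; case: ifP => // aB; rewrite minB ?mulr0 // toggle_in //.
by rewrite [in ltnRHS](cardsD1 b) bB [in ltnRHS](cardsD1 a) aB ltnW.
Qed.

End PureForm.

Section Enumeration.
Variables (m : nat) (B : {set 'I_m}).

(** Lists [B] before its complement, so that the forms attached to [B] get the initial indices. The
    list has length [m], so the default of [nth] is never returned. *)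
Definition front_fun (a : 'I_m) : 'I_m := nth a (enum B ++ enum (~: B)) a.

Let size_front : size (enum B ++ enum (~: B)) = m.
Proof. by rewrite size_cat -!cardE cardsC card_ord. Qed.

Lemma front_fun_inj : injective front_fun.
Proof.
move=> a b; rewrite /front_fun (set_nth_default a b) ?size_front // => /eqP.
rewrite nth_uniq ?size_front // => [/eqP/val_inj//|].
rewrite cat_uniq !enum_uniq andbT; apply/hasPn => e.
by rewrite !mem_enum inE.
Qed.

Definition front_perm : 'S_m := perm front_fun_inj.

Lemma front_perm_in a : (front_perm a \in B) = (a < #|B|)%N.
Proof.
rewrite permE /front_fun nth_cat -cardE; case: ltnP => aB.
  by rewrite -mem_enum mem_nth // -cardE.
apply/negbTE; rewrite -in_setC -mem_enum mem_nth // -cardE.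
by rewrite ltn_subLR // cardsC card_ord.
Qed.

Lemma prod_front_perm (R : pzSemiRingType) (F : 'I_m -> R) :
  \prod_(a : 'I_m | (a < #|B|)%N) F (front_perm a) = \prod_(b <- enum B) F b.
Proof.
have leB : (#|B| <= m)%N by rewrite -[leqRHS]card_ord max_card.
case: (posnP m) => [m0|mgt0].
  rewrite [LHS]big_pred0 => [|a]; last by move: (ltn_ord a); rewrite [X in (_ < X)%N]m0.
  have -> : enum B = [::] by apply/eqP;
    rewrite -size_eq0 -cardE -leqn0 (leq_trans leB) // m0.
  by rewrite big_nil.
pose a0 := Ordinal mgt0.
rewrite [RHS](big_nth a0) big_mkord -cardE (big_ord_widen _ (fun i =>
  F (nth a0 (enum B) i)) leB).
apply: eq_bigr => a aB; rewrite permE /front_fun nth_cat -cardE aB.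
by rewrite (set_nth_default a0) // -cardE.
Qed.

Lemma sum_front_perm (R : nmodType) (F : 'I_m -> R) :
  \sum_(a : 'I_m | (#|B| <= a)%N) F (front_perm a) = \sum_(b in ~: B) F b.
Proof.
rewrite [RHS](reindex_inj (@perm_inj _ front_perm)) /=; apply: eq_bigl => a.
by rewrite in_setC front_perm_in -leqNgt.
Qed.

End Enumeration.

Lemma disjoint_setU1 (T : finType) (a : T) (A B : {set T}) :
  [disjoint a |: A & B] = (a \notin B) && [disjoint A & B].
Proof. by rewrite !disjoints_subset subUset sub1set inE. Qed.

(** * Product form of an operator commuting with Lambda *)

Section CanonicalForm.
Variables (C : numClosedFieldType) (n : nat) (c : 'I_n.*2 -> 'M[C]_(2 ^ n)).
Hypothesis cc : forall a b, c a *m c b + c b *m c a = (2 * (a == b)%:R)%:M.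
Local Notation rep := (grassmann_rep c).
Local Notation cm := (cmonomial c).
Implicit Types (a b : 'I_n.*2) (S T B : {set 'I_n.*2}) (X Y : 'M[C]_(2 ^ n)).

(** The factors of [B] cancel those in [B :|: S]. The sign splits into [inversions B S] and a
    constant of [B] alone, which is all that [s] records. *)
Lemma rep_monomial_mul B : exists2 s : C, s != 0 & forall X S,
  [disjoint B & S] ->
  rep (cm B *m X) S = s * (-1) ^+ inversions B S * rep X (B :|: S).
Proof.
elim/ord_set_ind: B => [|a B ltaB [s s0 IHB]].
  exists 1; first exact: oner_neq0.
  by move=> X S _; rewrite cmonomial0 mul1mx inversions0l expr0 !mul1r set0U.
have aB : a \notin B by apply/negP => /ltaB; rewrite ltnn.
exists (s * (-1) ^+ inversions B [set a]).
  by rewrite mulf_neq0 // signr_eq0.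
move=> X S; rewrite disjoint_setU1 => /andP[aS BS].
rewrite cmonomialU1 // -mulmxA rep_generatorl // IHB; last first.
  by rewrite toggle_notin // disjoint_sym disjoint_setU1 aB disjoint_sym.
rewrite toggle_notin // (inversionsDr B (subsetUl [set a] S)).
rewrite (inversionsDl S (subsetUl [set a] B)) !setU1K // !exprD /gsign setUCA setUA.
by ring.
Qed.

Lemma lambda_commuting_monomial_mul B X :
  lambda_commuting c X -> lambda_commuting c (cm B *m X).
Proof.
move=> lX; elim/ord_set_ind: B => [|a B ltaB IHB].
  by rewrite cmonomial0 mul1mx.
rewrite cmonomialU1 // -mulmxA; apply: lambda_commutingM => //.
exact: lambda_commuting_generator.
Qed.

Lemma rep_monomial_mul_parity B X : geven (rep X) ->
  forall S, odd #|S| != odd #|B| -> rep (cm B *m X) S = 0.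
Proof.
move=> eX; elim/ord_set_ind: B => [|a B ltaB IHB] S SB.
  by rewrite cmonomial0 mul1mx eX //; move: SB; rewrite cards0; case: odd.
have aB : a \notin B by apply/negP => /ltaB; rewrite ltnn.
rewrite cmonomialU1 // -mulmxA rep_generatorl // IHB ?mulr0 // odd_toggle.
by move: SB; rewrite cardsU1 aB /=; do 2 case: odd.
Qed.

Lemma canonical_form X : geven (rep X) -> lambda_commuting c X ->
  exists (k : nat) (z : C) (M T : 'M[C]_(n.*2)),
     let mu (a : 'I_n.*2) : grassmann C n.*2 := \sum_b T a b *: theta C b in
     [/\ (k <= n)%N,
         (forall a b : 'I_n.*2, (k.*2 <= a)%N -> (k.*2 <= b)%N ->
            M b a = - M a b),
         T \in unitmx &
         rep X =
           z *: ((\prod_(a : 'I_n.*2 | (a < k.*2)%N) mu a) *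
             gexp (('i / 2) *:
               \sum_(a : 'I_n.*2 | (k.*2 <= a)%N)
                 \sum_(b : 'I_n.*2 | (k.*2 <= b)%N)
                   M a b *: (mu a * mu b)))].
Proof.
move=> eX lX; have [->|X0] := eqVneq X 0.
  exists 0%N, 0, 0, 1%:M; split=> //.
  - by move=> a b _ _; rewrite !mxE oppr0.
  - exact: unitmx1.
  - by rewrite scale0r linear0.
have [B [XB minB]] := minimal_support cc X0.
have pX : plucker (rep X) by apply/lambda_commuting_plucker.
have eB : ~~ odd #|B| by apply: contra XB => oB; rewrite eX.
have [s s0 sE] := rep_monomial_mul B.
(* Its coordinate at [set0] is a nonzero multiple of that of [X] at [B], so [Y] is an
   exponential. *)
pose Y := cm B *m X.
have Y0 : rep Y set0 != 0.
  rewrite /Y sE; last by rewrite -setI_eq0 setI0.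
  by rewrite setU0 !mulf_neq0 ?signr_eq0.
have eY : geven (rep Y).
  by move=> S oS; apply: rep_monomial_mul_parity => //; rewrite oS (negPf eB).
have lY : lambda_commuting c Y by apply: lambda_commuting_monomial_mul.
have [z [N [Nasym YE]]] : exp_form c Y.
  by apply: plucker_exp_form => //; apply/lambda_commuting_plucker.
pose q b a := dtheta a (rep X) (B :\ b).
have q0 b : b \in B -> q b b != 0.
  move=> bB; rewrite /q dthetaE !inE eqxx /= toggle_notin ?setD11 // setD1K //.
  by rewrite mulf_neq0 // signr_eq0.
(* Rows in [B] are the annihilating forms, scaled to have coefficient 1 at [theta b]; the other rows
   are unit vectors, completing them to a basis. *)
pose L : 'M[C]_n.*2 := \matrix_(b, a) if b \in B then q b a / q b b else (b == a)%:R.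
have LB a b : a \in B -> b \in B -> L b a = (b == a)%:R.
  move=> aB bB; rewrite mxE bB; have [<-|ba] := eqVneq b a; first by rewrite divff ?q0.
  by rewrite /q dthetaE !inE eq_sym ba aB mul0r.
have nuX b : b \in B -> linear_form (L b) * rep X = 0.
  move=> bB; have <- : (q b b)^-1 *: (linear_form (q b) * rep X) =
    linear_form (L b) * rep X.
    rewrite scalerAl scaler_sumr; congr (_ * _); apply: eq_bigr => a _.
    by rewrite scalerA mxE bB mulrC.
  by rewrite plucker_annihilator // scaler0.
have nuN b : b \notin B -> linear_form (L b) = theta C b.
  move=> bB; rewrite /linear_form (bigD1 b) //= [X in _ + X]big1 => [|a ab].
    by rewrite mxE (negPf bB) eqxx scale1r addr0.
  by rewrite mxE (negPf bB) eq_sym (negPf ab) scale0r.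
have Lunit : L \in unitmx.
  (* [D] has rows in [B] and columns outside [B] only, so its square is 0 and [1%:M - D] inverts
     [L]. *)
  pose D := L - 1%:M.
  have DE b a : D b a = if (b \in B) && (a \notin B) then q b a / q b b else 0.
    rewrite !mxE; case: (boolP (b \in B)) => bB /=; last by rewrite subrr.
    case: (boolP (a \in B)) => aB /=; last first.
      by case: eqP aB => [<-|_ _]; rewrite ?bB ?subr0.
    by have := LB a b aB bB; rewrite mxE bB => ->; rewrite subrr.
  have DD : D *m D = 0.
    apply/matrixP => b a; rewrite mxE [RHS]mxE big1 // => e _; rewrite !DE.
    by case: (e \in B); rewrite /= ?andbF ?mul0r ?mulr0.
  suff /mulmx1_unit[] : L *m (1%:M - D) = 1%:M by [].
  have -> : L = 1%:M + D by rewrite addrC subrK.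
  by rewrite mulmxDl mul1mx mulmxBr mulmx1 DD subr0 subrK.
pose y := gproj (~: B) (rep Y).
have XE : s *: rep X = (\prod_(b <- enum B) linear_form (L b)) * y.
  apply: factor_linear_forms => // [S nSB|S BS]; first by rewrite gprojE (negPf nSB).
  by rewrite gprojE -disjoints_subset disjoint_sym BS sE.
pose f := front_perm B; pose T := row_perm f L.
have muE a : \sum_b T a b *: theta C b = linear_form (L (f a)).
  by apply: eq_bigr => b _; rewrite mxE.
have B2 : #|B| = #|B|./2.*2 by rewrite -[LHS]odd_double_half (negPf eB).
(* Here 2k is the size of [B], [T] is [L] with its rows reordered to put [B] first, and [M] is [N]
   reordered likewise; [s^-1] undoes the factor in [XE]. *)
exists #|B|./2, (s^-1 * z), (\matrix_(a, b) N (f a) (f b)), T; rewrite -B2 /=; split.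
- by rewrite -leq_double -B2 -[leqRHS]card_ord max_card.
- by move=> a b _ _; rewrite !mxE; move/matrixP/(_ (f a) (f b)): Nasym; rewrite !mxE.
- by rewrite /T row_permE unitmx_mul unitmx_perm.
under eq_bigr do rewrite muE.
rewrite (prod_front_perm B (fun b => linear_form (L b))).
have -> : \sum_(a : 'I_n.*2 | (#|B| <= a)%N) \sum_(b : 'I_n.*2 | (#|B| <= b)%N)
    (\matrix_(a, b) N (f a) (f b)) a b *:
      ((\sum_e T a e *: theta C e) * (\sum_e T b e *: theta C e)) =
    \sum_(a in ~: B) \sum_(b in ~: B) N a b *: (theta C a * theta C b).
  rewrite -sum_front_perm; apply: eq_bigr => a aB.
  rewrite -sum_front_perm; apply: eq_bigr => b bB.
  by rewrite mxE !muE !nuN // front_perm_in -leqNgt.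
have -> : rep X = s^-1 *: (s *: rep X) by rewrite scalerA mulVf // scale1r.
rewrite XE -[RHS]scalerA; congr (_ *: _); rewrite scalerAr; congr (_ * _).
(* The projection passes through the exponential and drops the terms of [N] that meet [B]; outside
   [B] the new forms are the [theta b] themselves. *)
rewrite /y YE linearZ /= gproj_gexp linearZ /=; congr (_ *: gexp (_ *: _)).
rewrite linear_sum [RHS]big_mkcond; apply: eq_bigr => a _.
rewrite linear_sum /=; case: ifP => aB.
  rewrite [RHS]big_mkcond; apply: eq_bigr => b _.
  rewrite linearZ rmorphM /= !gproj_theta aB.
  by case: ifP => _; rewrite ?mulr0 ?scaler0.
by apply: big1 => b _; rewrite linearZ rmorphM /= gproj_theta aB mul0r scaler0.
Qed.

End CanonicalForm.

Theorem theorem1 (R : realType) (n : nat) (hn : (1 <= n)%N)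
    (c : 'I_n.*2 -> 'M[R[i]]_(2 ^ n)) (hc : clifford_generators c) :
  (forall X : 'M[R[i]]_(2 ^ n),
     gaussian c X <->
     even_op c X /\ commutator (Lambda c) (X *t X) = 0) /\
  (forall X : 'M[R[i]]_(2 ^ n), gaussian c X ->
     exists (k : nat) (z : R[i]) (M T : 'M[R[i]]_(n.*2)),
       let mu (a : 'I_n.*2) : grassmann R[i] n.*2 :=
         \sum_b T a b *: theta R[i] b in
       [/\ (k <= n)%N,
           (forall a b : 'I_n.*2, (k.*2 <= a)%N -> (k.*2 <= b)%N ->
              M b a = - M a b),
           T \in unitmx &
           grassmann_rep c X =
             z *: ((\prod_(a : 'I_n.*2 | (a < k.*2)%N) mu a) *
               gexp (('i / 2) *:
                 \sum_(a : 'I_n.*2 | (k.*2 <= a)%N)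
                   \sum_(b : 'I_n.*2 | (k.*2 <= b)%N)
                     M a b *: (mu a * mu b)))]).
Proof.
have cc := hc.2; have arch := @complex_archimedean R.
split=> [X|X]; first exact: gaussianP.
by move=> /(gaussianP cc X arch)[/(even_opP cc)]; exact: canonical_form.
Qed.
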